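(* Let $n\ge 3$ and $l\ge 2$ be integers. (i) If $l\ge 4$ and $l$ is even, then there is a constant $C_l>0$ depending only on $l$ such that $\mathrm{ex}(CT_n,C_{2l})\le C_l\, n^{-1+\frac{2}{l}}\, e(CT_n)$ for all $n\ge 3$. (ii) If $l\ge 4$ and $l$ is odd, then there is a constant $C_l>0$ depending only on $l$ such that for all $n\ge 3$: if $l=7$ then $\mathrm{ex}(CT_n,C_{2l})\le C_l\, n^{-\frac{1}{l}}\, e(CT_n)$, and otherwise $\mathrm{ex}(CT_n,C_{2l})\le C_l\, n^{-\frac18+\frac{1}{4(l-3)}}\, e(CT_n)$. (iii) If $l=3$, then $\mathrm{ex}(CT_n,C_{6})\le (\sqrt2-1+o(1))\, e(CT_n)$ as $n\to\infty$. (iv) If $l=2$, then $\mathrm{ex}(CT_n,C_{4})\le \frac34\, e(CT_n)$.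
   Context: $\mathrm{S}_n$ is the symmetric group on $\{1,\dots,n\}$. The complete transposition graph $CT_n$ is the Cayley graph on $\mathrm{S}_n$ whose connection set is the set of all transpositions: its vertex set is $\mathrm{S}_n$ and $\{x,y\}$ is an edge iff $yx^{-1}$ is a transposition. It is $\binom n2$-regular and bipartite with $n!$ vertices, so $e(CT_n)=\frac{n!}{2}\binom n2$. $C_m$ denotes the cycle of length $m$. For graphs $G$ and $H$, $\mathrm{ex}(G,H)$ is the maximum number of edges of a spanning subgraph of $G$ that contains no subgraph isomorphic to $H$. *)

(* Defs.v *)
From Stdlib Require Import Reals.
From mathcomp Require Import all_boot all_fingroup.

Set Implicit Arguments.
Unset Strict Implicit.
Unset Printing Implicit Defensive.

Local Open Scope group_scope.

Definition is_transposition (n : nat) (s : 'S_n) : bool :=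
  [exists i : 'I_n, exists j : 'I_n, (i != j) && (s == tperm i j)].

Definition CT_edges (n : nat) : {set {set 'S_n}} :=
  [set e : {set 'S_n} | [exists x : 'S_n, exists y : 'S_n,
     (e == [set x; y]) && is_transposition (y * x^-1)]].

Definition eCT (n : nat) : nat := #|CT_edges n|.

(* a spanning subgraph of CT_n, given by its edge set *)
Definition is_subgraph (n : nat) (F : {set {set 'S_n}}) : bool :=
  F \subset CT_edges n.

Definition has_cycle (n m : nat) (F : {set {set 'S_n}}) : bool :=
  [exists f : {ffun 'I_m -> 'S_n},
     injectiveb f && [forall i : 'I_m, [set f i; f (ordS i)] \in F]].

Definition exCT (n m : nat) : nat :=
  \max_(F : {set {set 'S_n}} | is_subgraph F && ~~ has_cycle m F) #|F|.

(* Main.v *)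
Require Import Defs.
From Stdlib Require Import Reals Lra Psatz.
From mathcomp Require Import all_boot all_fingroup zify.

(* For a vertex x and a C_2l-free subgraph F, let G_x be the graph on the transpositions
   in which u and v are joined if they are disjoint and the path ux - uvx - vx lies in F.
   A cycle C_l in G_x unfolds to a C_2l in F, while summing over x shows that the graphs
   G_x have on average about d^2 ordered edges, d being the average degree of F.

   (i) For even l this contradicts the Bondy-Simonovits theorem as soon as d is much
   larger than n^(1+2/l).  That theorem is proved by breadth-first search from a root: if
   two consecutive layers (or one layer) spanned a subgraph of large minimum degree, then
   by downward induction on the level any two neighbours of a vertex would have the same
   ancestor on each level, for otherwise a greedily chosen path closes up through the tree
   to a 2k-cycle; at the end of the induction the neighbours themselves coincide.  Hence
   the layers grow by a factor of order of the minimum degree.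

   (ii) For odd l = 2m + 3, triples a, b, c of disjoint transpositions such that F contains
   the edges from abcx to abx, acx, bcx form a 3-graph with about d^3 ordered edges.  By
   Cauchy-Schwarz two transpositions c1, c2 have a common link with a 2m-cycle and a
   pendant edge; its unfolding over c1 together with a detour over c2 is a C_2l.  This even
   gives the exponent -1/3 + 1/(3m), which implies the stated ones; for l = 5 the exponent
   is 0.

   (iii) This is Chung's argument for the hypercube: G_x is triangle-free and each
   transposition has at most one G_x-neighbour among the F-neighbours of x, so Mantel's
   theorem on the remaining transpositions gives p^2 + 2p <= 1 + o(1) for the density p.

   (iv) Average over the 4-cycles x, ax, bax, abax with a, b overlapping. *)

Set Implicit Arguments.
Unset Strict Implicit.
Unset Printing Implicit Defensive.

(** * Even cycles in graphs *)

Definition npairs (V : finType) (e : rel V) (A B : {set V}) : nat :=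
  \sum_(u in A) \sum_(v in B) e u v.

Definition degree_in (V : finType) (e : rel V) (S : {set V}) (v : V) : nat :=
  \sum_(u in S) e v u.

(** Delete vertices of degree below [s] one at a time: each deletion destroys fewer than [2 * s]
    ordered pairs, an edge being counted in both directions. *)
Lemma npairs_degenerate (V : finType) (e : rel V) (s : nat) (W : {set V}) :
  symmetric e ->
  (forall S : {set V}, S \subset W -> S != set0 ->
     exists2 v, v \in S & degree_in e S v < s) ->
  npairs e W W <= 2 * s * #|W|.
Proof.
move=> esym; move: {2}_.+1 (ltnSn #|W|) => N.
elim: N W => // N IH W ltW degW.
have [->|W0] := eqVneq W set0; first by rewrite /npairs big_set0.
have [v vW degv] := degW W (subxx _) W0.
have cardW : #|W| = (#|W :\ v|).+1 by rewrite (cardsD1 v W) vW.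
have IHv : npairs e (W :\ v) (W :\ v) <= 2 * s * #|W :\ v|.
  apply: IH => [|S SW]; first by lia.
  by apply: degW; apply: subset_trans SW (subsetDl _ _).
have -> : npairs e W W = degree_in e W v
    + (\sum_(u in W :\ v) e u v + npairs e (W :\ v) (W :\ v)).
  rewrite /npairs (big_setD1 v vW) /=; congr (_ + _).
  by rewrite -big_split; apply: eq_bigr => u _; rewrite (big_setD1 v vW).
have : \sum_(u in W :\ v) e u v <= degree_in e W v.
  rewrite /degree_in (big_setD1 v vW) /=.
  rewrite (eq_bigr (fun u => nat_of_bool (e v u))) ?leq_addl // => u _.
  by rewrite esym.
lia.
Qed.

Lemma min_degree_subset (V : finType) (e : rel V) (s : nat) (W : {set V}) :
  symmetric e -> 2 * s * #|W| < npairs e W W ->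
  exists S : {set V}, [/\ S \subset W, S != set0 &
    forall v, v \in S -> s <= degree_in e S v].
Proof.
move=> esym ltW.
case: (boolP [exists S : {set V}, [&& S \subset W, S != set0 &
    [forall v in S, s <= degree_in e S v]]]) => [/existsP[S /and3P[? ? /forall_inP ?]]|].
  by exists S.
move=> /existsPn noS; exfalso.
have := @npairs_degenerate V e s W esym _; rewrite leqNgt ltW => /(_ _)/negP.
case=> // S SW S0; move: (noS S); rewrite SW S0 /= negb_forall_in.
by case/exists_inP=> v vS; rewrite -ltnNge; exists v.
Qed.

Lemma degree_in_fresh (V : finType) (e : rel V) (S : {set V}) (A : seq V) v :
  size A < degree_in e S v ->
  exists2 u, (u \in S) && e v u & u \notin A.
Proof.
move=> ltA.
case: (boolP [exists u, (u \in S) && e v u && (u \notin A)]) => [/existsP[u /andP[]]|].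
  by exists u.
move=> /existsPn H; move: ltA; rewrite ltnNge => /negP[].
have -> : degree_in e S v = #|[set u in S | e v u]|.
  by rewrite /degree_in -big_mkcondr /= sum1dep_card.
apply: leq_trans (card_size A); apply/subset_leq_card/subsetP => u.
rewrite inE => uS; move: (H u); rewrite uS /=; exact: negbNE.
Qed.

(** [A] holds the vertices to avoid. Each step moves the current vertex into [A] and shortens the
    rest by one, so the degree bound keeps supplying a fresh neighbour. *)
Lemma greedy_path (V : finType) (e : rel V) (S : {set V}) (s : nat) :
  (forall v, v \in S -> s <= degree_in e S v) ->
  forall (r : nat) (A : seq V) (y : V), y \in S -> size A + r < s ->
  exists p : seq V, [/\ path e y p, size p = r, uniq (y :: p),
    all [in S] p & ~~ has [in A] p].
Proof.
move=> degS; elim=> [|r IH] A y yS ltA; first by exists [::].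
have [|z /andP[zS yz] zA] := @degree_in_fresh V e S (y :: A) y.
  by apply: leq_trans (degS y yS) => /=; lia.
have [|p [pp sp up Sp Ap]] := IH (y :: A) z zS; first by rewrite /=; lia.
have {}Ap w : w \in p -> w \notin y :: A by move=> wp; apply: (hasPn Ap).
exists (z :: p); split.
- by rewrite /= yz.
- by rewrite /= sp.
- rewrite cons_uniq up andbT; apply/negP; rewrite inE => /orP[/eqP zy|/Ap].
    by move: zA; rewrite zy mem_head.
  by rewrite mem_head.
- by rewrite /= zS.
- apply/hasPn => w; rewrite inE => /orP[/eqP->|/Ap].
    by move: zA; rewrite inE negb_or => /andP[].
  by rewrite inE negb_or => /andP[].
Qed.

(** * Breadth-first search layers *)

(** A search tree from [r] that is reliable only up to depth [k]: vertices farther away, or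
    unreachable, need no parent. *)
Definition bfs_labelling (V : finType) (e : rel V) (k : nat) (r : V)
    (lev : V -> nat) (par : V -> V) : Prop :=
  [/\ forall v, (lev v == 0) = (v == r),
      forall v, 0 < lev v <= k -> e v (par v) /\ lev (par v) = (lev v).-1 &
      forall u v, e u v -> lev u <= k -> lev v <= (lev u).+1].

Lemma bfs_labelling_exists (V : finType) (e : rel V) (k : nat) (r : V) :
  symmetric e -> exists lev par, bfs_labelling e k r lev par.
Proof.
move=> esym.
pose ball := fix ball i : {set V} := if i is j.+1 then
  ball j :|: [set v | [exists u in ball j, e u v]] else [set r].
have ballS i : ball i \subset ball i.+1 by rewrite /= subsetUl.
have ballE i j : i <= j -> ball i \subset ball j.
  move/subnK <-; elim: (j - i) => //= m IH; apply: subset_trans IH _; exact: ballS.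
(* [find] returns [k.+1] for a vertex outside all these balls. *)
pose lev v := find (fun i => v \in ball i) (iota 0 k.+1).
have levE v i : i <= k -> (lev v <= i) = (v \in ball i).
  move=> ik; apply/idP/idP => [li|vi].
    have hv : has (fun i => v \in ball i) (iota 0 k.+1).
      by rewrite has_find size_iota (leq_ltn_trans li).
    have := nth_find 0 hv; rewrite nth_iota ?add0n; last by rewrite (leq_ltn_trans li).
    by apply: subsetP; apply: ballE.
  rewrite leqNgt; apply/negP => /(before_find 0).
  by rewrite nth_iota // add0n vi.
(* The default [v] does not occur on levels 1 to [k], where some neighbour lies in the ball one step
   closer to [r]. *)
pose par v := odflt v [pick u in ball (lev v).-1 | e v u].
have step u v : e u v -> lev u <= k -> lev v <= (lev u).+1.
  move=> uv uk; have [ltk|gek] := ltnP (lev u) k.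
    rewrite levE //= inE [X in _ || X]inE; apply/orP; right.
    by apply/exists_inP; exists u => //; rewrite -levE.
  by apply: leq_trans (find_size _ _) _; rewrite size_iota.
exists lev, par; split=> //.
  by move=> v; rewrite -leqn0 levE // inE.
move=> v /andP[v0 vk].
have vb : v \in ball (lev v).-1.+1 by rewrite prednK // -levE.
have ltv : (lev v).-1 < lev v by rewrite prednK.
have nv : v \notin ball (lev v).-1 by rewrite -levE -?ltnNge //; lia.
have [u ub uv] : exists2 u, u \in ball (lev v).-1 & e u v.
  by move: vb; rewrite /= inE (negPf nv) /= inE => /exists_inP[u]; exists u.
rewrite /par; case: pickP => [w /andP[wb vw]|/(_ u)] /=; last by rewrite ub esym uv.
split=> //; move: wb; rewrite -levE; last by lia.
move=> wl; have := step w v; rewrite esym vw => /(_ isT); lia.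
Qed.

Lemma lev_iter_par (V : finType) (e : rel V) (k : nat) (r : V) lev par :
  bfs_labelling e k r lev par ->
  forall a v, a <= lev v <= k -> lev (iter a par v) = lev v - a.
Proof.
case=> _ parP _; elim=> [|a IH] v /andP[av vk] /=; first by rewrite subn0.
have [|_ ->] := parP (iter a par v); rewrite IH; lia.
Qed.

Lemma path_traject_par (V : finType) (e : rel V) (k : nat) (r : V) lev par :
  bfs_labelling e k r lev par ->
  forall a v, a <= lev v <= k -> path e v (traject par (par v) a).
Proof.
case=> _ parP _; elim=> [|a IH] v // /andP[av vk].
have [|vp lp] := parP v; first by lia.
by rewrite /= vp IH //; lia.
Qed.

(** Climb from the end of [q] to the meeting point and descend to [x]. The branches lie on levels
    smaller than [i], hence off the path; a vertex on both would have the same height [j <= a] on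
    each, and the ancestors [a] levels up would coincide. *)
Lemma cycle_of_branches (V : finType) (e : rel V) (k i a : nat) (r x : V)
    (q : seq V) lev par :
  symmetric e -> bfs_labelling e k r lev par -> i <= k -> a < i ->
  path e x q -> uniq (x :: q) -> {in x :: q, forall v, i <= lev v} ->
  lev x = i -> lev (last x q) = i ->
  iter a par x != iter a par (last x q) ->
  iter a.+1 par x = iter a.+1 par (last x q) ->
  exists2 c, path.cycle e c && uniq c & size c = size q + 2 * a.+1.
Proof.
move=> esym bfs ik ai pq uq levq lx lx' neqa eqa.
set x' := last x q in lx' neqa eqa.
have levI v b : lev v = i -> b <= i -> lev (iter b par v) = i - b.
  by move=> lv bi; rewrite (lev_iter_par bfs) lv // bi.
have mem_tr v b w : w \in traject par (par v) b ->
    exists2 j, 0 < j <= b & w = iter j par v.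
  case/trajectP=> j jb ->; exists j.+1 => //; by rewrite iterSr.
have uniq_tr v b : lev v = i -> b <= i -> uniq (traject par (par v) b).
  move=> lv bi; elim: b v i {levI ai pq uq levq lx lx'} lv bi ik => // b IH v i' lv bi ik'.
  rewrite trajectS cons_uniq; have [|_ lp] := (let: And3 _ P _ := bfs in P) v; first by lia.
  rewrite (IH _ i'.-1) ?andbT; try lia.
  apply/negP => /mem_tr[j /andP[j0 jb] /(congr1 lev)].
  rewrite (lev_iter_par bfs) lp lv; lia.
(* The meeting point is put on the branch of [x'] only, whence the lengths [a.+1] and [a]. *)
set Tx' := traject par (par x') a.+1; set Tx := traject par (par x) a.
have lTx' : last x' Tx' = iter a.+1 par x' by exact: last_traject.
have pTx' : path e x' Tx' by apply: (path_traject_par bfs); rewrite lx' ai.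
have pTx : path e (iter a.+1 par x) (rcons (rev Tx) x).
  have bTx : belast x (traject par (par x) a.+1) = x :: Tx.
    by rewrite trajectSr belast_rcons.
  rewrite -(last_traject par x a.+1) -rev_cons -bTx rev_path.
  rewrite (eq_path (e' := e)); last by move=> u v; rewrite esym.
  by apply: (path_traject_par bfs); rewrite lx ai.
exists ((x :: q) ++ Tx' ++ rev Tx); last first.
  by rewrite !size_cat size_rev !size_traject /=; lia.
apply/andP; split.
  rewrite (_ : path.cycle _ _ = path e x (rcons (q ++ Tx' ++ rev Tx) x)) //.
  by rewrite rcons_cat cat_path pq -/x' rcons_cat cat_path pTx' lTx' -eqa.
rewrite cat_uniq uq cat_uniq rev_uniq !uniq_tr ?(ltnW ai) // !andTb andbT; apply/andP; split.
  apply/hasPn => v; rewrite mem_cat mem_rev => vT; apply/negP => /levq.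
  case/orP: vT => /mem_tr[j /andP[j0 ja] ->]; rewrite levI //; lia.
apply/hasPn => v; rewrite mem_rev => /mem_tr[j /andP[j0 ja] ->].
apply/negP => /mem_tr[j' /andP[j0' ja'] eqj].
have jj' : j' = j by move: (congr1 lev eqj); rewrite !levI //; lia.
move/eqP: neqa; apply; rewrite -(subnK ja) !iterD eqj; congr (iter _ _ _).
by rewrite jj'.
Qed.

Definition layer_rel (V : finType) (e : rel V) (lev : V -> nat) (i j : nat) : rel V :=
  fun u v => e u v && ((lev u == i) && (lev v == j) || (lev u == j) && (lev v == i)).

Lemma layer_rel_sym (V : finType) (e : rel V) lev i j :
  symmetric e -> symmetric (@layer_rel V e lev i j).
Proof.
move=> esym u v; rewrite /layer_rel esym orbC.
by rewrite [(lev u == i) && _]andbC [(lev u == j) && _]andbC.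
Qed.

(* Downward induction on [a]: if all neighbours of each [y] have the same ancestor
   [a.+1] levels up but two of them differ [a] levels up, a greedy path of the
   right length through [y] closes up along the tree to a cycle of length [2 * k]. *)
Lemma layer_neighbours_same_ancestor (V : finType) (e : rel V) (k i j : nat) (r : V)
    lev par (S : {set V}) :
  symmetric e -> irreflexive e -> bfs_labelling e k r lev par -> i < k -> i <= j ->
  (forall c, path.cycle e c -> uniq c -> size c <> 2 * k) ->
  (forall v, v \in S -> 2 * k + 2 <= degree_in (layer_rel e lev i j) S v) ->
  forall a y x x', a <= i -> y \in S -> x \in S -> x' \in S -> lev y = j ->
  layer_rel e lev i j y x -> layer_rel e lev i j y x' ->
  iter a par x = iter a par x'.
Proof.
move=> esym eirr bfs ik ij noC degS.
have hsym := layer_rel_sym lev i j esym.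
set h := layer_rel e lev i j in degS hsym *.
have hX y x : lev y = j -> h y x -> lev x = i.
  by move=> ly /andP[_]; rewrite ly eqxx /= => /orP[/andP[/eqP <- /eqP]|/eqP].
have hY x y : lev x = i -> h x y -> lev y = j.
  by move=> lx /andP[_]; rewrite lx eqxx /= => /orP[/eqP|/andP[/eqP <- /eqP]].
have hlev u v : h u v -> i <= lev v.
  by case/andP=> _ /orP[]/andP[_ /eqP->].
suff main d a : a + d = i -> forall y x x', y \in S -> x \in S -> x' \in S ->
    lev y = j -> h y x -> h y x' -> iter a par x = iter a par x'.
  by move=> a y x x' ai; apply: (main (i - a)); rewrite subnKC.
elim: d a => [|d IH] a adi y x x' yS xS x'S ly yx yx'.
  have top v : lev v = i -> iter a par v = r.
    case: (bfs) => lev0 _ _ lv; apply/eqP; rewrite -lev0 (lev_iter_par bfs) lv; lia.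
  by rewrite !top //; apply: (hX y).
have {}IH := IH a.+1 ltac:(lia).
(* Preceded by a neighbour of [y], this path has [2 * (k - a.+1)] edges; the tree will contribute
   the missing [2 * a.+1]. *)
have [p [pp sp up pS pA]] : exists p : seq V, [/\ path h y p,
    size p = (2 * (k - a.+1)).-1, uniq (y :: p), all [in S] p
    & ~~ has [in [:: x; x']] p].
  by apply: (greedy_path degS) => //=; lia.
have ak : a.+1 < k by lia.
have lenp : size (y :: p) = 2 * (k - a.+1).
  by rewrite /= sp prednK // muln_gt0 subn_gt0.
(* Vertices two steps apart on such a walk share a neighbour on level [j], so [IH] carries the
   ancestor [a.+1] levels up along the walk. *)
have alt m z q : size q = 2 * m -> z \in S -> lev z = i -> path h z q -> all [in S] q ->
    lev (last z q) = i /\ iter a.+1 par z = iter a.+1 par (last z q).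
  elim: m z q => [|m IHm] z q; first by rewrite muln0 => /size0nil->.
  rewrite mulnS; case: q => [|u [|w q]] //= [sq] zS lz /and3P[zu uw pq] /and3P[uS wS qS].
  have lu := hY _ _ lz zu; have lw := hX _ _ lu uw.
  have [|lq eqq] := IHm w q _ wS lw pq qS; first by [].
  split=> //; apply: etrans eqq; apply: (IH u) => //; by rewrite hsym.
(* If [z] and the end of [p] differed [a] levels up, [cycle_of_branches] would give a cycle of
   length [2 * k]. So [x] and [x'] both agree there with the end of [p]. *)
have end_p z : z \in S -> h y z -> z \notin p -> iter a par z = iter a par (last y p).
  move=> zS yz zp; apply/eqP/negPn/negP => neq.
  have lz := hX _ _ ly yz.
  have phz : path h z (y :: p) by rewrite /= hsym yz.
  have [|lq eqq] := alt _ z (y :: p) lenp zS lz phz; first by rewrite /= yS.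
  have zy : z != y.
    by apply/eqP => zy; move: yz; rewrite zy /h /layer_rel eirr.
  have [||||c] := @cycle_of_branches V e k i a r z (y :: p) lev par esym bfs (ltnW ik) _ _ _ _ lz lq neq eqq.
  - by rewrite -adi addnS ltnS leq_addr.
  - by apply: sub_path phz => u v /andP[].
  - by rewrite cons_uniq inE negb_or zy zp.
  - have levp u q : i <= lev u -> path h u q -> {in u :: q, forall v, i <= lev v}.
      elim: q u => [|w q IHq] u lu /=; first by move=> _ v; rewrite inE => /eqP->.
      case/andP=> uw wq v; rewrite inE => /orP[/eqP->//|]; apply: IHq wq v.
      exact: hlev uw.
    by apply: levp phz; rewrite lz.
  - case/andP=> cc uc sc; apply: (noC c) => //; by rewrite sc lenp -mulnDr subnK // ltnW.
move: pA; rewrite has_sym /= orbF negb_or => /andP[xp x'p].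
by rewrite !end_p.
Qed.

(** More pairs would yield a subgraph of minimum degree [2 * k + 2], where
    [layer_neighbours_same_ancestor] with [a = 0] makes all neighbours of a vertex on level [j]
    equal. *)
Lemma npairs_layers (V : finType) (e : rel V) (k i j : nat) (r : V) lev par :
  symmetric e -> irreflexive e -> bfs_labelling e k r lev par -> i < k -> i <= j ->
  (forall c, path.cycle e c -> uniq c -> size c <> 2 * k) ->
  npairs e [set v | lev v == i] [set v | lev v == j] <=
    2 * (2 * k + 2) * (#|[set v | lev v == i]| + #|[set v | lev v == j]|).
Proof.
move=> esym eirr bfs ik ij noC; set Li := [set v | _]; set Lj := [set v | _].
rewrite leqNgt; apply/negP => lt.
pose h := layer_rel e lev i j; pose W := Li :|: Lj.
have hsym : symmetric h by exact: layer_rel_sym.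
have [] := @min_degree_subset V h (2 * k + 2) W hsym.
  apply: leq_ltn_trans (leq_trans lt _).
    by rewrite leq_mul2l cardsU leq_subr orbT.
  have lew (A B : {set V}) (f g : V -> nat) : A \subset B ->
      (forall u, u \in A -> f u <= g u) -> \sum_(u in A) f u <= \sum_(u in B) g u.
    move=> AB fg; rewrite [X in _ <= X](big_setID A) /= (setIidPr AB).
    by apply: leq_trans (leq_addr _ _); apply: leq_sum.
  rewrite /npairs; apply: (lew Li W); [exact: subsetUl | move=> u uL].
  apply: (lew Lj W); [exact: subsetUr | move=> v vL].
  move: uL vL; rewrite !inE /h /layer_rel => -> ->.
  by case: (e u v).
move=> S [SW S0 degS].
have [y yS ly] : exists2 y, y \in S & lev y = j.
  have [v vS] := set0Pn _ S0.
  have := subsetP SW _ vS; rewrite !inE => /orP[] /eqP lv; last by exists v.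
  have [|y /andP[yS /andP[_]]] := @degree_in_fresh V h S [::] v.
    by apply: leq_trans (degS v vS); rewrite addn2.
  by rewrite lv eqxx => /orP[/eqP|/andP[/eqP <- /eqP]] yj _; exists y.
have [|x /andP[xS yx] _] := @degree_in_fresh V h S [::] y.
  by apply: leq_trans (degS y yS); rewrite addn2.
have [|x' /andP[x'S yx'] xx'] := @degree_in_fresh V h S [:: x] y.
  by apply: leq_trans (degS y yS); rewrite addn2.
have := @layer_neighbours_same_ancestor V e k i j r lev par S esym eirr bfs ik ij
  noC degS 0 y x x' (leq0n _) yS xS x'S ly yx yx'.
by move=> /= xE; move: xx'; rewrite xE mem_head.
Qed.

(** The Bondy-Simonovits theorem in minimum degree form: without the cycle every layer is at least
    [t] times as large as the one before, so layer [k] does not fit into [S]. *)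
Lemma even_cycle_min_degree (V : finType) (e : rel V) (k t : nat) :
  symmetric e -> irreflexive e -> 0 < k -> 0 < t ->
  forall S : {set V}, S != set0 ->
  (forall u v, e u v -> u \in S) -> #|S| < t ^ k ->
  (forall v, v \in S -> 2 * (2 * k + 2) * (t + 5) <= degree_in e S v) ->
  exists c : (2 * k).-tuple V, path.cycle e c && uniq c.
Proof.
move=> esym eirr k0 t0 S S0 eS cardS degS; apply/existsP.
apply: contraT => /existsPn noT; exfalso.
have noC c : path.cycle e c -> uniq c -> size c <> 2 * k.
  by move=> cc uc /eqP sc; move: (noT (Tuple sc)); rewrite /= cc uc.
have [r rS] := set0Pn _ S0.
have [lev [par bfs]] := bfs_labelling_exists k r esym.
have [lev0 parP levS] := bfs.
pose L i := [set v | lev v == i].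
have LS i : i <= k -> L i \subset S.
  move=> ik; apply/subsetP => v; rewrite inE => /eqP lv.
  case: i ik lv => [_ /eqP|i ik lv]; first by rewrite lev0 => /eqP->.
  have [|+ _] := parP v; first by lia.
  exact: eS.
(* Edges from layer [i] end in layers [i.-1], [i] and [i.+1], and [npairs_layers] bounds each of the
   three groups. For [i = 0] the first group merely repeats the second. *)
have step i : i < k -> 2 * (2 * k + 2) * (t + 5) * #|L i| <=
    2 * (2 * k + 2) * (#|L i.-1| + 4 * #|L i| + #|L i.+1|).
  move=> ik; apply: (@leq_trans (npairs e (L i.-1) (L i) + npairs e (L i) (L i) +
    npairs e (L i) (L i.+1))).
    have -> : npairs e (L i.-1) (L i) = npairs e (L i) (L i.-1).
      rewrite /npairs exchange_big; apply: eq_bigr => u _.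
      by apply: eq_bigr => v _; rewrite esym.
    rewrite /npairs -!big_split /= mulnC -sum_nat_const; apply: leq_sum => u uL.
    apply: leq_trans (degS u _) _; first by apply: (subsetP (LS i (ltnW ik))).
    rewrite /degree_in.
    rewrite [X in _ <= X + _ + _]big_mkcond [X in _ <= _ + X + _]big_mkcond.
    rewrite [X in _ <= _ + X]big_mkcond [X in X <= _]big_mkcond -!big_split /=.
    apply: leq_sum => v _; case: (v \in S) => //.
    case uv : (e u v); last by do ! case: ifP.
    move: uL; rewrite !inE => /eqP lu.
    have := levS u v uv; have := levS v u; rewrite esym uv => /(_ isT).
    do ! case: ifP; lia.
  have bnd a b := @npairs_layers V e k a b r lev par esym eirr bfs.
  have b1 := bnd i.-1 i ltac:(lia) ltac:(lia) noC.
  have b2 := bnd i i ltac:(lia) ltac:(lia) noC.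
  have b3 := bnd i i.+1 ltac:(lia) ltac:(lia) noC.
  rewrite -/(L i.-1) -/(L i) -/(L i.+1) in b1 b2 b3.
  apply: leq_trans (leq_add (leq_add b1 b2) b3) _.
  by rewrite -!mulnDr leq_mul2l; lia.
(* Monotonicity bounds [#|L i.-1| + 4 * #|L i|] by [5 * #|L i|], which the 5 in [t + 5] absorbs. *)
have grow i : i <= k -> t ^ i <= #|L i| /\ #|L i.-1| <= #|L i|.
  elim: i => [|i IH] ik.
    split=> //; rewrite expn0 card_gt0; apply/set0Pn; exists r.
    by rewrite inE lev0.
  have [g1 g2] := IH (ltnW ik); have := step i ik.
  rewrite -mulnA leq_mul2l addn2 /= => g3.
  have g4 : t * #|L i| <= #|L i.+1| by lia.
  rewrite expnS /=; split; first by apply: leq_trans g4; rewrite leq_mul2l g1 orbT.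
  by apply: leq_trans g4; apply: leq_pmull.
have [] := grow k (leqnn k); have := subset_leq_card (LS k (leqnn k)); lia.
Qed.

(** The density gives minimum degree [2 * (2 * k + 2) * (t + 5)] on some [S]. This exceeds [2 * k],
    so a vertex of the cycle has a neighbour off the cycle; odd [l] needs that edge. *)
Lemma even_cycle_with_pendant (V : finType) (e : rel V) (W : {set V}) (k t : nat) :
  symmetric e -> irreflexive e -> 0 < k -> #|W| < t ^ k ->
  8 * (k + 1) * (t + 5) * #|W| < npairs e W W ->
  exists v c u, [/\ path.cycle e (v :: c), uniq (v :: c), size (v :: c) = 2 * k,
    e v u & u \notin v :: c].
Proof.
move=> esym eirr k0 ltW ltp.
have [|S [SW S0 degS]] := @min_degree_subset V e (2 * (2 * k + 2) * (t + 5)) W esym.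
  by apply: leq_ltn_trans ltp; lia.
pose eS u v := [&& e u v, u \in S & v \in S].
have degE v : v \in S -> degree_in eS S v = degree_in e S v.
  by move=> vS; apply: eq_bigr => u uS; rewrite /eS vS uS !andbT.
have [||||||c] := @even_cycle_min_degree V eS k t _ _ k0 _ S S0.
- by move=> u v; rewrite /eS esym [(u \in S) && _]andbC.
- by move=> u; rewrite /eS eirr.
- by case: t ltW {ltp degS} => //; rewrite exp0n.
- by move=> u v /and3P[].
- exact: leq_ltn_trans (subset_leq_card SW) ltW.
- by move=> v vS; rewrite degE // degS.
case/andP; case: c => -[|v c] /= sc; first by move: sc; lia.
move=> cc uc'; have {cc}cc : path.cycle eS (v :: c) := cc.
have {uc'}uc : uniq (v :: c) := uc'.
have cS : {subset v :: c <= S}.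
  move=> w /(next_cycle cc); by case/and3P.
have vS : v \in S by apply: cS; rewrite mem_head.
have [|u /andP[uS vu] nuc] := @degree_in_fresh V e S (v :: c) v.
  apply: leq_trans (degS v vS); rewrite /= (eqP sc); nia.
exists v, c, u; split=> //.
- by apply: sub_cycle cc => a b /and3P[].
- exact/eqP.
Qed.

(** * Cycles from disjoint transpositions *)

Local Open Scope group_scope.

Definition transpositions (n : nat) : {set 'S_n} := [set s | is_transposition s].

Definition moved (n : nat) (s : 'S_n) : {set 'I_n} := [set i | s i != i].

Definition dj (n : nat) (a b : 'S_n) : bool := [disjoint moved a & moved b].

Definition adj (n : nat) (F : {set {set 'S_n}}) : rel 'S_n :=
  fun x y => [set x; y] \in F.

(** For a product of disjoint transpositions this is the set of its factors. Comparing these sets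
    will tell vertices [p * x] apart. *)
Definition factors (n : nat) (p : 'S_n) : {set 'S_n} :=
  [set t in transpositions n | [exists i, (p i == t i) && (t i != i)]].

Lemma transpositionP n (t : 'S_n) :
  reflect (exists i j, i != j /\ t = tperm i j) (t \in transpositions n).
Proof.
rewrite inE; apply: (iffP existsP) => [[i /existsP[j /andP[ij /eqP->]]]|[i [j [ij ->]]]].
  by exists i, j.
by exists i; apply/existsP; exists j; rewrite ij eqxx.
Qed.

Lemma transposition_moved n (t : 'S_n) i :
  t \in transpositions n -> t i != i -> t = tperm i (t i).
Proof.
case/transpositionP=> a [b [ab ->]].
by case: tpermP => [->|->|]; rewrite ?eqxx // tpermC.
Qed.

Lemma transpositionK n (t : 'S_n) : t \in transpositions n -> t * t = 1.
Proof. by case/transpositionP=> a [b [_ ->]]; rewrite tperm2. Qed.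

Lemma transpositionV n (t : 'S_n) : t \in transpositions n -> t^-1 = t.
Proof. by case/transpositionP=> a [b [_ ->]]; rewrite tpermV. Qed.

Lemma transposition_exmoved n (t : 'S_n) :
  t \in transpositions n -> exists i, t i != i.
Proof. by case/transpositionP=> a [b [ab ->]]; exists a; rewrite tpermL eq_sym. Qed.

Lemma transposition_neq1 n (t : 'S_n) : t \in transpositions n -> t != 1.
Proof.
case/transposition_exmoved=> i; apply: contraNneq => ->; by rewrite perm1.
Qed.

Lemma djP n (a b : 'S_n) : reflect (forall i, a i != i -> b i = i) (dj a b).
Proof.
apply: (iffP idP) => [/disjointFr ab i ai|ab].
  by have := ab i; rewrite !inE ai => /(_ isT)/negbFE/eqP.
by apply/pred0P => i /=; rewrite !inE; apply/negP => /andP[/ab->]; rewrite eqxx.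
Qed.

Lemma dj_sym n : symmetric (@dj n).
Proof. by move=> a b; rewrite /dj disjoint_sym. Qed.

Lemma dj_commute n (a b : 'S_n) : dj a b -> a * b = b * a.
Proof.
move=> ab; have ba := ab; rewrite dj_sym in ba; move/djP: ab => ab; move/djP: ba => ba.
apply/permP => i; rewrite !permM.
have [ai|ai] := eqVneq (a i) i; last first.
  by rewrite (ab i ai) ab // (inj_eq perm_inj).
have [bi|bi] := eqVneq (b i) i; first by rewrite ai bi ai.
by rewrite ai [RHS]ba // (inj_eq perm_inj).
Qed.

Lemma dj_neq n (a b : 'S_n) : a \in transpositions n -> dj a b -> a != b.
Proof.
case/transposition_exmoved=> i ai /djP/(_ i ai) bi.
by apply: contraNneq ai => ->; rewrite bi.
Qed.

Lemma dj_mul n (a b c : 'S_n) : dj a c -> dj b c -> dj (a * b) c.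
Proof.
move=> /djP ac /djP bc; apply/djP => i; rewrite permM.
have [->|ai _] := eqVneq (a i) i; [exact: bc|exact: ac].
Qed.

Lemma dj1 n (a : 'S_n) : dj 1 a.
Proof. by apply/djP => i; rewrite perm1 eqxx. Qed.

Lemma factors_mul n (p t : 'S_n) :
  t \in transpositions n -> dj p t -> factors (p * t) = t |: factors p.
Proof.
move=> tT pt; have tp := pt; rewrite dj_sym in tp.
move/djP: (pt) => ptP; move/djP: (tp) => tpP.
apply/setP => u; rewrite in_setU1 [in LHS]inE [in RHS]inE.
apply/andP/idP => [[uT /existsP[i /andP[/eqP ui ui']]]|].
  move: ui; rewrite (dj_commute pt) permM.
  have [->|ti] := eqVneq (t i) i.
    by move=> pi; apply/orP; right; rewrite uT; apply/existsP; exists i; rewrite pi eqxx.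
  rewrite tpP ?(inj_eq perm_inj) // => tu; apply/orP; left; apply/eqP.
  by rewrite (transposition_moved uT ui') -tu -transposition_moved.
case/orP=> [/eqP->|/andP[uT /existsP[i /andP[/eqP pu ui]]]]; split=> //.
  have [i ti] := transposition_exmoved tT; apply/existsP; exists i.
  by rewrite permM tpP // eqxx.
apply/existsP; exists i; rewrite (dj_commute pt) permM ui andbT.
by rewrite ptP pu.
Qed.

Lemma factors1 n : factors (1 : 'S_n) = set0.
Proof.
apply/setP => t; rewrite !inE; apply/negP => /andP[_ /existsP[i]].
by rewrite perm1 eq_sym => /andP[->].
Qed.

Lemma factors_transposition n (a : 'S_n) :
  a \in transpositions n -> factors a = [set a].
Proof. by move=> aT; rewrite -[a in LHS]mul1g factors_mul ?dj1 // factors1 setU0. Qed.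

Lemma factors2 n (a b : 'S_n) :
  a \in transpositions n -> b \in transpositions n -> dj a b ->
  factors (a * b) = [set a; b].
Proof. by move=> aT bT ab; rewrite factors_mul // factors_transposition // setUC. Qed.

Lemma factors3 n (a b c : 'S_n) :
  a \in transpositions n -> b \in transpositions n -> c \in transpositions n ->
  dj a b -> dj a c -> dj b c -> factors (a * b * c) = [set a; b; c].
Proof.
by move=> aT bT cT ab ac bc; rewrite factors_mul ?dj_mul // factors2 // setUC.
Qed.

Lemma adj_sym n (F : {set {set 'S_n}}) : symmetric (adj F).
Proof. by move=> x y; rewrite /adj setUC. Qed.

Lemma has_cycle_seq n (F : {set {set 'S_n}}) (s : seq 'S_n) (m : nat) :
  path.cycle (adj F) s -> uniq s -> size s = m -> has_cycle m F.
Proof.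
move=> cs us sm; apply/existsP; exists [ffun i : 'I_m => nth 1 s i].
apply/andP; split.
  apply/injectiveP => i j; rewrite !ffunE => /eqP.
  by rewrite nth_uniq ?sm // => /eqP/val_inj.
apply/forallP => i; rewrite !ffunE /=.
have is_ : nth 1 s i \in s by rewrite mem_nth // sm.
have := next_cycle cs is_; rewrite next_nth is_ /adj.
congr ([set _; _] \in F); case: s cs us sm is_ => // y p cs us sm is_.
rewrite index_uniq ?sm //; have := ltn_ord i; rewrite -[X in _ < X]sm /= ltnS leq_eqVlt.
(* At the last index [nth] falls back on its default, the head of the list, which matches the
   wrap-around of [ordS]. *)
case/orP=> [/eqP ip|ip].
  by rewrite ip nth_default // -sm /= modnn.
rewrite modn_small -?[X in _ < X]sm //=; exact: set_nth_default.
Qed.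

(** * Link graphs and unfolded cycles *)

Definition link (n : nat) (F : {set {set 'S_n}}) (x : 'S_n) : rel 'S_n :=
  fun u v => [&& u \in transpositions n, v \in transpositions n, dj u v,
    adj F (u * x) (u * v * x) & adj F (v * x) (u * v * x)].

Lemma link_sym n (F : {set {set 'S_n}}) x : symmetric (link F x).
Proof.
move=> u v; rewrite /link [dj v u]dj_sym.
case uT : (u \in _); case vT : (v \in _) => //=; case: (boolP (dj u v)) => //= uv.
by rewrite (dj_commute uv) andbC.
Qed.

Lemma link_irr n (F : {set {set 'S_n}}) x : irreflexive (link F x).
Proof.
move=> u; apply/negP => /and5P[uT _ uu _ _].
by have := dj_neq uT uu; rewrite eqxx.
Qed.

(** The unfolding of a path of directions, without its first vertex [u * x], as [path] expects
    it. *)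
Fixpoint link_walk (n : nat) (x u : 'S_n) (p : seq 'S_n) : seq 'S_n :=
  if p is v :: p' then u * v * x :: v * x :: link_walk x v p' else [::].

Lemma size_link_walk n (x u : 'S_n) p : size (link_walk x u p) = (2 * size p)%N.
Proof. elim: p u => //= v p IH u; rewrite IH; lia. Qed.

Lemma last_link_walk n (x u : 'S_n) p :
  last (u * x) (link_walk x u p) = last u p * x.
Proof. by elim: p u => //= v p IH u. Qed.

Lemma path_link_walk n (F : {set {set 'S_n}}) (x u : 'S_n) p :
  path (link F x) u p -> path (adj F) (u * x) (link_walk x u p).
Proof.
elim: p u => //= v p IH u /andP[/and5P[_ _ _ -> vuv] /IH->].
by rewrite adj_sym vuv.
Qed.

Lemma mem_link_walk n (e : rel 'S_n) (x u : 'S_n) p w :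
  path e u p -> w \in u * x :: link_walk x u p ->
  (exists2 y, y \in u :: p & w = y * x) \/
  (exists y z, [/\ y \in u :: p, z \in u :: p, e y z & w = y * z * x]).
Proof.
elim: p u => [|v p IH] u /=.
  by move=> _; rewrite inE => /eqP->; left; exists u; rewrite ?mem_head.
case/andP=> uv pp; rewrite inE => /orP[/eqP->|].
  by left; exists u; rewrite ?mem_head.
rewrite inE => /orP[/eqP->|/(IH _ pp)[[y yp ->]|[y [z [yp zp yz ->]]]]].
- by right; exists u, v; rewrite !inE !eqxx orbT.
- by left; exists y; rewrite // inE yp orbT.
- by right; exists y, z; split; rewrite // inE ?yp ?zp orbT.
Qed.

(** Used to prove distinctness: a vertex with a factor outside the path of directions is off the
    unfolded walk. *)
Lemma factors_link_walk n (F : {set {set 'S_n}}) (x u : 'S_n) p w :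
  u \in transpositions n -> path (link F x) u p ->
  w \in u * x :: link_walk x u p -> {subset factors (w * x^-1) <= u :: p}.
Proof.
move=> uT pp.
have pT : {subset u :: p <= transpositions n}.
  elim: p u uT pp => [|v p IH] u uT /=; first by move=> _ y; rewrite inE => /eqP->.
  case/andP=> /and5P[_ vT _ _ _] pp y; rewrite inE => /orP[/eqP->//|]; exact: IH.
case/(mem_link_walk pp) => [[y yp ->]|[y [z [yp zp /and5P[yT zT yz _ _] ->]]]] t; rewrite mulgK.
  by rewrite factors_transposition ?pT // inE => /eqP->.
by rewrite factors2 // !inE => /orP[] /eqP->.
Qed.

Lemma uniq_link_walk n (F : {set {set 'S_n}}) (x u : 'S_n) p :
  u \in transpositions n -> path (link F x) u p -> uniq (u :: p) ->
  uniq (u * x :: link_walk x u p).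
Proof.
elim: p u => //= v p IH u uT /andP[/and5P[_ vT uv _ _] pp] /andP[nup up].
have fresh w : u \in factors (w * x^-1) -> w \notin v * x :: link_walk x v p.
  by move=> uw; apply: contraNN nup => /(factors_link_walk vT pp); apply.
rewrite inE negb_or -!andbA; apply/and4P; split.
- apply/eqP => /mulIg/esym/eqP; rewrite -{2}[u]mulg1 (inj_eq (mulgI u)).
  by apply/negP/transposition_neq1.
- by apply: fresh; rewrite mulgK factors_transposition // inE.
- by apply: fresh; rewrite mulgK factors2 // !inE eqxx.
- exact: IH.
Qed.

(* The cycle [v, c] of directions unfolds at [x] to the closed walk
   v x, v c_1 x, c_1 x, c_1 c_2 x, ..., which is cut open at [v x]. *)
Lemma link_cycle_open n (F : {set {set 'S_n}}) (x v : 'S_n) c :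
  path.cycle (link F x) (v :: c) -> uniq (v :: c) -> (1 < size c)%N ->
  let s := rcons (link_walk x v c) (last v c * v * x) in
  path (adj F) (v * x) s /\ uniq (v * x :: s).
Proof.
move=> cc uc sc s; rewrite {}/s; move: cc; rewrite [path.cycle _ _]/= rcons_path => /andP[pc lv].
have /and5P[zT vT zv a1 a2] := lv.
split.
  by rewrite rcons_path path_link_walk //= last_link_walk.
rewrite -rcons_cons rcons_uniq (uniq_link_walk vT pc uc) andbT.
case: c uc sc pc lv zT zv a1 a2 => //= y p /and3P[]; rewrite inE negb_or.
move=> /andP[vy vp] yp up sp /andP[vey pp] lv zT zv _ _.
have /and5P[_ yT dvy _ _] := vey.
set z := last y p in zT zv lv *.
have zp : z \in p by rewrite /z; case: (p) sp => //= a q _; apply: mem_last.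
have f2 : factors (z * v * x * x^-1) = [set z; v] by rewrite mulgK factors2.
rewrite inE negb_or; apply/andP; split.
  apply/eqP => /(congr1 (fun w => z \in factors (w * x^-1))).
  rewrite f2 mulgK factors_transposition // !inE eqxx /=.
  by move/esym/eqP => E; move: zp; rewrite E (negPf vp).
rewrite inE negb_or; apply/andP; split.
  apply/eqP => /(congr1 (fun w => z \in factors (w * x^-1))).
  rewrite f2 mulgK factors2 // !inE eqxx /=.
  by move/esym/orP=> [] /eqP E; move: zp; rewrite E ?(negPf vp) ?(negPf yp).
apply/negP => /(factors_link_walk yT pp); rewrite f2 => /(_ v).
by rewrite !inE eqxx orbT (negPf vy) (negPf vp) => /(_ isT).
Qed.

Lemma has_cycle_of_link n (F : {set {set 'S_n}}) (x : 'S_n) c m :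
  path.cycle (link F x) c -> uniq c -> size c = m -> (2 < m)%N -> has_cycle (2 * m) F.
Proof.
case: c => [|v c]; first by move=> _ _ <-.
move=> cc uc sc m2; have [|pc us] := @link_cycle_open n F x v c cc uc.
  by move: sc => /=; lia.
apply: (has_cycle_seq _ us).
  rewrite /= rcons_path pc last_rcons.
  by move: cc; rewrite /= rcons_path => /andP[_ /and5P[_ _ _ _]]; rewrite adj_sym.
by rewrite /= size_rcons size_link_walk; move: sc => /=; lia.
Qed.

(** * Links of triples *)

Definition link3 (n : nat) (F : {set {set 'S_n}}) (x a b c : 'S_n) : bool :=
  [&& [&& a \in transpositions n, b \in transpositions n & c \in transpositions n],
      [&& dj a b, dj a c & dj b c] &
      [&& adj F (a * b * c * x) (a * b * x), adj F (a * b * c * x) (a * c * x) &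
          adj F (a * b * c * x) (b * c * x)]].

Definition common_link (n : nat) (F : {set {set 'S_n}}) (x c1 c2 : 'S_n) : rel 'S_n :=
  fun u v => link3 F x u v c1 && link3 F x u v c2.

Lemma link3C n (F : {set {set 'S_n}}) x a b c : link3 F x a b c = link3 F x b a c.
Proof.
rewrite /link3 [dj b a]dj_sym.
case aT : (a \in _); case bT : (b \in _); rewrite ?andbF //=.
case cT : (c \in _) => //=; case: (boolP (dj a b)) => //= ab.
rewrite (dj_commute ab) [dj b c && _]andbC; congr (_ && _); congr (_ && _).
by rewrite andbC.
Qed.

Lemma common_link_sym n (F : {set {set 'S_n}}) x c1 c2 :
  symmetric (common_link F x c1 c2).
Proof. by move=> u v; rewrite /common_link 2!(link3C F x u). Qed.

(** The edges from [u * v * c * x] to [u * c * x] and [v * c * x] form a link path based at [c * x].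
    The third edge, to [u * v * x], allows a change of the apex [c] and serves the detour. *)
Lemma link3_link n (F : {set {set 'S_n}}) x u v c :
  link3 F x u v c -> link F (c * x) u v.
Proof.
case/and3P=> /and3P[uT vT cT] /and3P[uv uc vc] /and3P[a1 a2 a3].
by rewrite /link uT vT uv !mulgA [adj _ _ (_ * _ * _ * _)]adj_sym a2 adj_sym a3.
Qed.

Lemma common_link_irr n (F : {set {set 'S_n}}) x c1 c2 :
  irreflexive (common_link F x c1 c2).
Proof. by move=> u; apply/negP => /andP[/link3_link]; rewrite link_irr. Qed.

(* In the layer through [c1 * x] the cycle [v, c] unfolds to an open walk from
   v c1 x to z v c1 x, with z the last direction; the pendant direction [u] and
   the second apex [c2] provide a detour of seven edges back to v c1 x. *)
Lemma has_cycle_of_common_link n (F : {set {set 'S_n}}) (x c1 c2 u v : 'S_n) c m :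
  c1 != c2 -> path.cycle (common_link F x c1 c2) (v :: c) -> uniq (v :: c) ->
  size (v :: c) = m -> (2 < m)%N -> common_link F x c1 c2 v u -> u \notin v :: c ->
  has_cycle (2 * (m + 3)) F.
Proof.
move=> c12 cc uc sc m2 vu nu.
have cc1 : path.cycle (link F (c1 * x)) (v :: c).
  by apply: sub_cycle cc => a b /andP[/link3_link].
have [|pw uw] := @link_cycle_open n F (c1 * x) v c cc1 uc.
  by move: sc => /=; lia.
move: (cc); rewrite [path.cycle _ _]/= rcons_path => /andP[pc zvL].
set z := last v c in pw uw zvL *; set s := rcons _ _ in pw uw.
have zc : z \in c by rewrite /z; case: (c) sc m2 => [<-//|a q] /= _ _; apply: mem_last.
have /andP[/and3P[/and3P[zT vT c1T] /and3P[zv zc1 vc1] /and3P[z1a _ _]]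
  /and3P[/and3P[_ _ c2T] /and3P[_ zc2 vc2] /and3P[z2a z2b z2c]]] := zvL.
have /andP[/and3P[/and3P[_ uT _] /and3P[dvu _ uc1] /and3P[u1a u1b _]]
  /and3P[_ /and3P[_ _ uc2] /and3P[u2a u2b _]]] := vu.
pose tl := [:: z * v * x; z * v * c2 * x; v * c2 * x; v * u * c2 * x; v * u * x;
  v * u * c1 * x].
have zNv : z != v by apply: contraTneq zc => ->; case/andP: uc.
have zNu : z != u by apply: contraNneq nu => <-; rewrite inE zc orbT.
have vNu : v != u by apply: contraNneq nu => <-; rewrite mem_head.
have zNc1 := dj_neq zT zc1; have zNc2 := dj_neq zT zc2.
have vNc1 := dj_neq vT vc1; have vNc2 := dj_neq vT vc2.
have uNc1 := dj_neq uT uc1; have uNc2 := dj_neq uT uc2.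
pose f w := factors (w * x^-1).
(* The six detour vertices have distinct codes. Vertices of the open walk contain [c1] and miss [u],
   which no detour vertex does. *)
pose code w := [:: z \in f w; u \in f w; c1 \in f w; c2 \in f w].
have codeE : map code tl = [:: [:: true; false; false; false]; [:: true; false; false; true];
    [:: false; false; false; true]; [:: false; true; false; true];
    [:: false; true; false; false]; [:: false; true; true; false]].
  have N (a b : 'S_n) : a != b -> ((a == b) = false) * ((b == a) = false).
    by move=> ab; split; apply/negbTE; rewrite // eq_sym.
  rewrite /tl /= /code /f !mulgK (factors2 zT vT zv) (factors2 vT c2T vc2).
  rewrite (factors2 vT uT dvu) (factors3 zT vT c2T zv zc2 vc2).
  rewrite (factors3 vT uT c2T dvu vc2 uc2) (factors3 vT uT c1T dvu vc1 uc1) !inE !eqxx.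
  by rewrite !(N _ _ zNv, N _ _ zNu, N _ _ vNu, N _ _ zNc1, N _ _ zNc2, N _ _ vNc1,
    N _ _ vNc2, N _ _ uNc1, N _ _ uNc2, N _ _ c12) ?orbT.
have walk_code w : w \in v * (c1 * x) :: s -> (c1 \in f w) && (u \notin f w).
  rewrite /s -rcons_cons mem_rcons inE => w_in.
  have {w_in} : (exists2 y, y \in v :: c & w = y * (c1 * x)) \/
      (exists y y', [/\ y \in v :: c, y' \in v :: c, common_link F x c1 c2 y y'
        & w = y * y' * (c1 * x)]).
    case/orP: w_in => [/eqP->|/(mem_link_walk pc)//].
    by right; exists z, v; split; rewrite // ?mem_head // inE zc orbT.
  have vcT y : y \in v :: c -> (y != u) && (y \in transpositions n) && dj y c1.
    move=> yc; rewrite -andbA; apply/andP; split.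
      by apply: contraNneq nu => <-.
    by have /andP[/and3P[/and3P[-> _ _] /and3P[_ -> _] _] _] := next_cycle cc yc.
  case=> [[y yc ->]|[y [y' [yc y'c yy' ->]]]]; rewrite /f !mulgA mulgK.
    have /andP[/andP[yu yT] yc1] := vcT _ yc.
    rewrite (factors2 yT c1T yc1) !inE eqxx orbT /=.
    by rewrite negb_or ![u == _]eq_sym yu eq_sym.
  have /andP[/andP[yu yT] yc1] := vcT _ yc.
  have /andP[/andP[y'u y'T] y'c1] := vcT _ y'c.
  have /andP[/and3P[_ /and3P[dyy' _ _] _] _] := yy'.
  rewrite (factors3 yT y'T c1T dyy' yc1 y'c1) !inE eqxx !orbT /=.
  by rewrite !negb_or ![u == _]eq_sym yu y'u eq_sym.
apply: (@has_cycle_seq n F (v * (c1 * x) :: s ++ tl)); last first.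
- rewrite /= size_cat size_rcons size_link_walk; move: sc => /=; clear; lia.
- rewrite -cat_cons cat_uniq uw andTb; apply/andP; split; last first.
    by apply: (@map_uniq _ _ code); rewrite codeE.
  apply/hasPn => w wt; apply/negP => /walk_code.
  have := map_f code wt; rewrite codeE /code.
  by do 4 case: (_ \in f w).
rewrite [path.cycle _ _]/= rcons_cat cat_path pw /s last_rcons /tl /=.
by rewrite !mulgA z1a (adj_sym F (z * v * x)) z2a z2c (adj_sym F (v * c2 * x)) u2b u2a
  (adj_sym F (v * u * x)) u1a u1b.
Qed.

(** The hexagon is [x], [b * x], [a * b * x], [a * x], [a * c * x], [c * x]. *)
Lemma has_cycle6_of_two_neighbours n (F : {set {set 'S_n}}) (x a b c : 'S_n) :
  b != c -> link F x a b -> link F x a c -> adj F x (b * x) -> adj F x (c * x) ->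
  has_cycle 6 F.
Proof.
move=> bc /and5P[aT bT ab ab1 ab2] /and5P[_ cT ac ac1 ac2] xb xc.
apply: (@has_cycle_seq n F [:: x; b * x; a * b * x; a * x; a * c * x; c * x]) => //.
  by rewrite /= xb ab2 adj_sym ab1 ac1 (adj_sym F (a * c * x)) ac2 adj_sym xc.
pose f w := factors (w * x^-1); pose code w := [:: a \in f w; b \in f w; c \in f w].
apply: (@map_uniq _ _ code).
have N (s t : 'S_n) : s != t -> ((s == t) = false) * ((t == s) = false).
  by move=> st; split; apply/negbTE; rewrite // eq_sym.
rewrite /= /code /f !mulgK mulgV factors1 (factors2 aT bT ab) (factors2 aT cT ac).
rewrite !factors_transposition // !inE !eqxx.
by rewrite !(N _ _ bc, N _ _ (dj_neq aT ab), N _ _ (dj_neq aT ac)).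
Qed.

Lemma has_cycle4_of_overlap n (F : {set {set 'S_n}}) (x a b : 'S_n) :
  a \in transpositions n -> b \in transpositions n -> a * b != b * a ->
  adj F x (a * x) -> adj F (a * x) (b * a * x) -> adj F (b * a * x) (a * b * a * x) ->
  adj F (a * b * a * x) x -> has_cycle 4 F.
Proof.
move=> aT bT ab e1 e2 e3 e4.
apply: (@has_cycle_seq n F [:: x; a * x; b * a * x; a * b * a * x]) => //.
  by rewrite /= e1 e2 e3 e4.
have aN := transposition_neq1 aT; have bN := transposition_neq1 bT.
have baN : b * a != 1.
  by apply: contraNneq ab => ba; rewrite ba -(mulgK a b) ba mul1g mulgV.
have abN : a * b != 1.
  by apply: contraNneq ab => ba; rewrite ba -(mulKg a b) ba mulg1 mulVg.
have R (s : 'S_n) : (1 == s) = (s == 1) by rewrite eq_sym.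
have Ra (s : 'S_n) : (a == s * a) = (s == 1).
  by rewrite -{1}[a]mul1g (inj_eq (mulIg a)) R.
have aba : (a * b * a == 1) = (b == 1).
  by rewrite -(inj_eq (mulIg a)) -mulgA (transpositionK aT) mulg1 mul1g
    -{2}[a]mulg1 (inj_eq (mulgI a)).
have baba : (b * a == a * b * a) = (a == 1).
  by rewrite -{1}[b]mul1g !(inj_eq (mulIg _)) R.
have -> : [:: x; a * x; b * a * x; a * b * a * x] =
    [seq s * x | s <- [:: 1; a; b * a; a * b * a]] by rewrite /= mul1g.
rewrite (map_inj_uniq (mulIg x)) /= !inE !R !Ra aba baba.
by rewrite (negPf aN) (negPf bN) (negPf baN) (negPf abN).
Qed.

(** * Counting disjoint pairs and triples of neighbours *)

(** Neighbours are recorded as directions [t], so that the sets at different vertices are all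
    subsets of [transpositions n]. *)
Definition nbrs (n : nat) (F : {set {set 'S_n}}) (y : 'S_n) : {set 'S_n} :=
  [set t in transpositions n | adj F y (t * y)].

Lemma nbrsS n (F : {set {set 'S_n}}) y : nbrs F y \subset transpositions n.
Proof. by apply/subsetP => t; rewrite inE => /andP[]. Qed.

Lemma in_nbrs n (F : {set {set 'S_n}}) (t y : 'S_n) :
  t \in transpositions n -> (t \in nbrs F y) = adj F y (t * y).
Proof. by move=> tT; rewrite inE tT. Qed.

Lemma mul_transposition_neq n (t x : 'S_n) : t \in transpositions n -> t * x != x.
Proof.
move=> tT; rewrite -{2}[x]mul1g (inj_eq (mulIg x)); exact: transposition_neq1.
Qed.

(** Handshake count: [t] corresponds to the edge [[set y; t * y]], and the same [t] leads back from
    the other end. *)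
Lemma sum_card_nbrs n (F : {set {set 'S_n}}) :
  is_subgraph F -> \sum_y #|nbrs F y| = (2 * #|F|)%N.
Proof.
move=> /subsetP FCT.
have card_edges y : #|nbrs F y| = #|[set e in F | y \in e]|.
  rewrite -(card_in_imset (f := fun t => [set y; t * y])); last first.
    move=> s t /(subsetP (nbrsS F y)) sT _ /setP/(_ (s * y)).
    rewrite !inE eqxx orbT (negPf (mul_transposition_neq y sT)) /=.
    by move/esym/eqP/mulIg.
  apply: eq_card => e; apply/imsetP/idP => [[t]|].
    by rewrite inE => /andP[tT yt] ->; rewrite !inE eqxx /= andbT.
  rewrite inE => /andP[eF ye]; have := FCT e eF.
  rewrite inE => /existsP[a /existsP[b /andP[/eqP eE tT]]].
  have {}tT : b * a^-1 \in transpositions n by rewrite inE.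
  move: ye; rewrite eE !inE => /orP[/eqP ya|/eqP yb].
    exists (b * a^-1); rewrite ya ?mulgKV // in_nbrs // mulgKV.
    by rewrite /adj -eE.
  have tb : b * a^-1 * b = a by rewrite -(transpositionV tT) invMg invgK mulgKV.
  exists (b * a^-1); rewrite yb ?tb; first by rewrite in_nbrs // tb /adj setUC -eE.
  by rewrite setUC.
rewrite (eq_bigr (fun y => \sum_(e in F) (y \in e : nat))); last first.
  by move=> y _; rewrite card_edges -sum1dep_card big_mkcondr.
rewrite exchange_big /= mulnC -sum_nat_const; apply: eq_bigr => e /FCT.
rewrite inE => /existsP[a /existsP[b /andP[/eqP-> tT]]].
have ab : b != a.
  apply: contraTneq tT => ->; rewrite mulgV; apply/negP => T1.
  by have := @transposition_neq1 n 1; rewrite inE T1 eqxx => /(_ isT).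
rewrite -big_mkcond /= sum1_card.
by rewrite (eq_card (B := [set a; b])) // cards2 eq_sym ab.
Qed.

Lemma nbrs_CT n (y : 'S_n) : nbrs (CT_edges n) y = transpositions n.
Proof.
apply/setP => t; rewrite inE; case tT : (t \in _) => //=.
rewrite /adj inE; apply/existsP; exists y; apply/existsP; exists (t * y).
by rewrite eqxx mulgK; move: tT; rewrite inE.
Qed.

Lemma eCT_double n : (2 * eCT n = n`! * #|transpositions n|)%N.
Proof.
rewrite -sum_card_nbrs; last by rewrite /is_subgraph.
under eq_bigr do rewrite nbrs_CT.
by rewrite sum_nat_const; congr (_ * _)%N; rewrite card_Sn.
Qed.

Lemma moved_tperm n (i j : 'I_n) : i != j -> moved (tperm i j) = [set i; j].
Proof.
move=> ij; apply/setP => k; rewrite !inE.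
case: tpermP => [->|->|/eqP/negPf-> /eqP/negPf->]; rewrite ?eqxx ?orbT //.
by rewrite eq_sym.
Qed.

(** The transpositions moving [i] are the [tperm i j] with [j != i], and each transposition moves
    two points. *)
Lemma sum_transpositions n (f : 'S_n -> nat) :
  \sum_i \sum_(j | j != i) f (tperm i j) = (2 * \sum_(t in transpositions n) f t)%N.
Proof.
rewrite (eq_bigr (fun i => \sum_(t in transpositions n | t i != i) f t)).
  rewrite (exchange_big_dep (mem (transpositions n))) //=; last by move=> i t _ /andP[].
  rewrite [RHS]big_distrr /=.
  apply: eq_bigr => t /[dup] tT /transpositionP[i [j [ij tE]]].
  rewrite (eq_bigl [in moved t]); last by move=> k; rewrite tT !inE.
  by rewrite sum_nat_const tE moved_tperm // cards2 ij.
move=> i _; rewrite (reindex_onto (tperm i) (fun t : 'S_n => t i)) /=.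
  apply: eq_bigl => j; rewrite tpermL eqxx andbT; case ji : (j != i); last first.
    by rewrite andbF.
  rewrite andbT; apply/esym/transpositionP; by exists i, j; rewrite eq_sym.
move=> t /andP[tT ti]; by rewrite -transposition_moved.
Qed.

Lemma card_transpositions n : (2 * #|transpositions n| = n * n.-1)%N.
Proof.
rewrite -sum1_card -sum_transpositions.
under eq_bigr do rewrite sum1dep_card.
rewrite (eq_bigr (fun=> n.-1)) ?sum_nat_const ?card_ord // => i _.
by rewrite -[in RHS](card_ord n) -(cardsC1 i); apply: eq_card => j; rewrite !inE.
Qed.

(** A transposition meeting [u] moves one of its two points and is determined by that point and its
    image. *)
Lemma card_not_dj n (u : 'S_n) : u \in transpositions n ->
  (#|[set v in transpositions n | ~~ dj u v]| <= 2 * n)%N.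
Proof.
case/transpositionP=> i [j [ij uE]].
apply: (@leq_trans #|[set tperm p.1 p.2 | p : 'I_n * 'I_n in setX [set i; j] [set: 'I_n]]|).
  apply/subset_leq_card/subsetP => v; rewrite inE => /andP[vT].
  case/pred0Pn=> p /andP[pu pv]; rewrite !inE in pv.
  apply/imsetP; exists (p, v p); last by rewrite /= -transposition_moved.
  by move: pu; rewrite uE moved_tperm // !inE andbT.
apply: leq_trans (leq_imset_card _ _) _.
by rewrite cardsX cards2 ij cardsT card_ord.
Qed.

Lemma sum_dj_ge n (D : {set 'S_n}) (u : 'S_n) :
  D \subset transpositions n -> u \in transpositions n ->
  (#|D| - 2 * n <= \sum_(v in D) dj u v)%N.
Proof.
move=> DT uT; rewrite leq_subLR.
have -> : #|D| = (\sum_(v in D) (~~ dj u v) + \sum_(v in D) dj u v)%N.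
  by rewrite -sum1_card -big_split; apply: eq_bigr => v _; case: dj.
rewrite leq_add2r; apply: leq_trans (card_not_dj uT).
rewrite -big_mkcondr /= sum1dep_card; apply/subset_leq_card/subsetP => v.
by rewrite !inE => /andP[/(subsetP DT)]; rewrite inE => -> ->.
Qed.

Lemma sum_dj2_ge n (D : {set 'S_n}) (u v : 'S_n) :
  D \subset transpositions n -> u \in transpositions n -> v \in transpositions n ->
  (#|D| - 4 * n <= \sum_(w in D) (dj u w && dj v w))%N.
Proof.
move=> DT uT vT; have := sum_dj_ge DT uT; have := sum_dj_ge DT vT.
have : (\sum_(w in D) dj u w + \sum_(w in D) dj v w <=
    #|D| + \sum_(w in D) (dj u w && dj v w))%N.
  by rewrite -sum1_card -!big_split; apply: leq_sum => w _; do 2 case: dj.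
lia.
Qed.

Lemma sum_subset (I : finType) (D A : {set I}) (f : I -> nat) : D \subset A ->
  \sum_(u in D) f u = \sum_(u in A) ((u \in D) * f u)%N.
Proof.
move=> DA; rewrite [RHS](big_setID D) /= (setIidPr DA) [X in (_ + X)%N]big1.
  by rewrite addn0; apply: eq_bigr => u ->; rewrite mul1n.
by move=> u /setDP[_ /negPf->].
Qed.

(** Double counting by the middle vertex [y = u * v * x] of a link path: its neighbours [u * x] and
    [v * x] lie in the directions [v] and [u]. *)
Lemma sum_link_pairs n (F : {set {set 'S_n}}) :
  \sum_x npairs (link F x) (transpositions n) (transpositions n) =
  \sum_y \sum_(u in nbrs F y) \sum_(v in nbrs F y) dj u v.
Proof.
rewrite /npairs exchange_big /=.
transitivity (\sum_(u in transpositions n) \sum_(v in transpositions n)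
    \sum_y [&& u \in nbrs F y, v \in nbrs F y & dj u v]).
  apply: eq_bigr => u uT; rewrite exchange_big /=; apply: eq_bigr => v vT.
  rewrite (reindex_inj (mulgI (u * v))) /=; apply: eq_bigr => y _; congr nat_of_bool.
  rewrite /link uT vT /= !in_nbrs // [RHS]andbA [RHS]andbC.
  case: (boolP (dj u v)) => //= uv.
  have e1 : u * (u * v * y) = v * y by rewrite !mulgA (transpositionK uT) mul1g.
  have e2 : v * (u * v * y) = u * y.
    by rewrite (dj_commute uv) !mulgA (transpositionK vT) mul1g.
  have e3 : u * v * (u * v * y) = y by rewrite -mulgA e2 mulgA (transpositionK uT) mul1g.
  by rewrite e1 e2 e3 andbC !(adj_sym F y).
rewrite [RHS](eq_bigr (fun y => \sum_(u in transpositions n)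
    \sum_(v in transpositions n) [&& u \in nbrs F y, v \in nbrs F y & dj u v])).
  by rewrite [RHS]exchange_big /=; apply: eq_bigr => u _; rewrite [RHS]exchange_big.
move=> y _.
rewrite (sum_subset _ (nbrsS F y)); apply: eq_bigr => u _.
rewrite (sum_subset _ (nbrsS F y)) big_distrr.
by apply: eq_bigr => v _; rewrite /= !mulnb.
Qed.

Definition link3_count (n : nat) (F : {set {set 'S_n}}) (x : 'S_n) : nat :=
  \sum_(a in transpositions n) \sum_(b in transpositions n)
    \sum_(c in transpositions n) link3 F x a b c.

(** As for pairs, with the centre [y = a * b * c * x]: [a * b * x], [a * c * x], [b * c * x] lie in
    its directions [c], [b], [a]. *)
Lemma sum_link3_count n (F : {set {set 'S_n}}) :
  \sum_x link3_count F x = \sum_y \sum_(a in nbrs F y) \sum_(b in nbrs F y)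
    \sum_(c in nbrs F y) [&& dj a b, dj a c & dj b c].
Proof.
rewrite /link3_count exchange_big /=.
transitivity (\sum_(a in transpositions n) \sum_(b in transpositions n)
    \sum_(c in transpositions n) \sum_y [&& a \in nbrs F y, b \in nbrs F y,
      c \in nbrs F y & [&& dj a b, dj a c & dj b c]]).
  apply: eq_bigr => a aT; rewrite exchange_big /=; apply: eq_bigr => b bT.
  rewrite exchange_big /=; apply: eq_bigr => c cT.
  rewrite (reindex_inj (mulgI (a * b * c))) /=; apply: eq_bigr => y _.
  congr nat_of_bool; rewrite /link3 aT bT cT /= !in_nbrs //.
  case: (boolP (dj a b)) => ab; rewrite ?andbF //=.
  case: (boolP (dj a c)) => ac; rewrite ?andbF //=.
  case: (boolP (dj b c)) => bc; rewrite ?andbF //= andbT.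
  have K3 (s t : 'S_n) : s \in transpositions n -> s * (s * t) = t.
    by move=> sT; rewrite mulgA (transpositionK sT) mul1g.
  have e1 : a * b * (a * b * c * y) = c * y.
    by rewrite {1}(dj_commute ab) -!mulgA !K3.
  have e2 : a * c * (a * b * c * y) = b * y.
    by rewrite -(mulgA a b c) (dj_commute bc) (dj_commute ac) -!mulgA !K3.
  have e3 : b * c * (a * b * c * y) = a * y.
    have -> : a * b * c = b * c * a.
      by rewrite (dj_commute ab) -mulgA (dj_commute ac) mulgA.
    by rewrite {1}(dj_commute bc) -!mulgA !K3.
  have e4 : a * b * c * (a * b * c * y) = y.
    by rewrite -{1}(mulgA a b c) -(mulgA a (b * c)) e3 K3.
  rewrite e1 e2 e3 e4; by do 3 case: (adj F y _).
rewrite [RHS](eq_bigr (fun y => \sum_(a in transpositions n)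
    \sum_(b in transpositions n) \sum_(c in transpositions n) [&& a \in nbrs F y,
      b \in nbrs F y, c \in nbrs F y & [&& dj a b, dj a c & dj b c]])).
  rewrite [RHS]exchange_big /=; apply: eq_bigr => a _.
  rewrite [RHS]exchange_big /=; apply: eq_bigr => b _.
  by rewrite [RHS]exchange_big.
move=> y _.
rewrite (sum_subset _ (nbrsS F y)); apply: eq_bigr => a _.
rewrite (sum_subset _ (nbrsS F y)) big_distrr /=; apply: eq_bigr => b _.
rewrite (sum_subset _ (nbrsS F y)) !big_distrr /=.
by apply: eq_bigr => c _; rewrite /= !mulnb.
Qed.

Lemma link_pairs_ge n (D : {set 'S_n}) : D \subset transpositions n ->
  ((#|D| - 2 * n) ^ 2 <= \sum_(u in D) \sum_(v in D) dj u v)%N.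
Proof.
move=> DT; apply: (@leq_trans (#|D| * (#|D| - 2 * n))).
  by rewrite expnS expn1 leq_mul2r leq_subr orbT.
rewrite -sum_nat_const; apply: leq_sum => u /(subsetP DT).
exact: sum_dj_ge.
Qed.

Lemma link_triples_ge n (D : {set 'S_n}) : D \subset transpositions n ->
  ((#|D| - 4 * n) ^ 3 <=
   \sum_(a in D) \sum_(b in D) \sum_(c in D) [&& dj a b, dj a c & dj b c])%N.
Proof.
move=> DT.
apply: (@leq_trans ((\sum_(u in D) \sum_(v in D) dj u v) * (#|D| - 4 * n))).
  rewrite expnSr leq_mul2r; apply/orP; right.
  apply: leq_trans (link_pairs_ge DT); rewrite leq_exp2r //; lia.
rewrite big_distrl /=; apply: leq_sum => a aD.
rewrite big_distrl /=; apply: leq_sum => b bD.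
have := sum_dj2_ge DT (subsetP DT _ aD) (subsetP DT _ bD).
by case: (dj a b) => //=; rewrite mul1n.
Qed.

Lemma sum_sqr_ge (I : finType) (A : {set I}) (g : I -> nat) :
  ((\sum_(i in A) g i) ^ 2 <= #|A| * \sum_(i in A) g i ^ 2)%N.
Proof.
rewrite -(leq_pmul2l (isT : 0 < 2)%N).
have -> : (2 * (\sum_(i in A) g i) ^ 2 =
    \sum_(i in A) \sum_(j in A) 2 * (g i * g j))%N.
  rewrite expnS expn1 big_distrl big_distrr /=; apply: eq_bigr => i _.
  by rewrite big_distrr big_distrr.
have -> : (2 * (#|A| * \sum_(i in A) g i ^ 2) =
    \sum_(i in A) \sum_(j in A) (g i ^ 2 + g j ^ 2))%N.
  rewrite mul2n -addnn -{1}sum_nat_const big_distrr /= -big_split /=.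
  apply: eq_bigr => i _; by rewrite big_split /= sum_nat_const addnC.
by apply: leq_sum => i _; apply: leq_sum => j _; apply: nat_Cauchy.
Qed.

(** Write S1, S2, S3 for the power sums. Summing x y^2 + x^2 y <= x^3 + y^3 over pairs gives S1 S2
    <= [#|A|] S3, and Cauchy-Schwarz bounds S1^2 by [#|A|] S2. *)
Lemma sum_cube_ge (I : finType) (A : {set I}) (g : I -> nat) :
  ((\sum_(i in A) g i) ^ 3 <= #|A| ^ 2 * \sum_(i in A) g i ^ 3)%N.
Proof.
have step : ((\sum_(i in A) g i) * (\sum_(i in A) g i ^ 2) <=
    #|A| * \sum_(i in A) g i ^ 3)%N.
  rewrite -(leq_pmul2l (isT : 0 < 2)%N).
  have -> : (2 * ((\sum_(i in A) g i) * (\sum_(i in A) g i ^ 2)) =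
      \sum_(i in A) \sum_(j in A) (g i * g j ^ 2 + g i ^ 2 * g j))%N.
    rewrite mul2n -addnn {2}mulnC !big_distrl /= -big_split /=.
    by apply: eq_bigr => i _; rewrite !big_distrr big_split.
  have -> : (2 * (#|A| * \sum_(i in A) g i ^ 3) =
      \sum_(i in A) \sum_(j in A) (g i ^ 3 + g j ^ 3))%N.
    rewrite mul2n -addnn -{1}sum_nat_const big_distrr /= -big_split /=.
    apply: eq_bigr => i _; by rewrite big_split /= sum_nat_const addnC.
  apply: leq_sum => i _; apply: leq_sum => j _; rewrite !expnS !expn0 !muln1.
  by have [ij|ij] := leqP (g i) (g j); [|move/ltnW in ij]; move/subnK: ij => <-; nia.
rewrite expnS; apply: leq_trans (leq_mul (leqnn _) (sum_sqr_ge A g)) _.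
by rewrite mulnCA expnS expn1 -mulnA leq_mul2l step orbT.
Qed.

Local Close Scope group_scope.

(** * Bounds on the number of edges *)

Lemma sum_in_setT (I : finType) (f : I -> nat) : \sum_(y in [set: I]) f y = \sum_y f y.
Proof. by apply: eq_bigl => y; rewrite inE. Qed.

Lemma sum_nbrs_excess n (F : {set {set 'S_n}}) (r : nat) : is_subgraph F ->
  2 * #|F| <= \sum_y (#|nbrs F y| - r) + r * n`!.
Proof.
move=> subF; rewrite -(sum_card_nbrs subF) -(card_Sn n) mulnC -sum_nat_const -big_split /=.
by apply: leq_sum => y _; rewrite addnC -leq_subLR.
Qed.

(** [g] is the total excess of the degrees over [2 * n], the allowance for directions that are not
    disjoint. Cauchy-Schwarz bounds [g ^ 2] through the number of link pairs, which is at most [K]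
    at each vertex. *)
Lemma even_cycle_free_bound n (F : {set {set 'S_n}}) (k t : nat) :
  is_subgraph F -> ~~ has_cycle (2 * (2 * k)) F -> 2 <= k ->
  #|transpositions n| < t ^ k ->
  exists g, 2 * #|F| <= g + 2 * n * n`! /\
    g ^ 2 <= n`! ^ 2 * (8 * (k + 1) * (t + 5) * #|transpositions n|).
Proof.
move=> subF noC k2 ltT; set K := 8 * _ * _ * _.
exists (\sum_y (#|nbrs F y| - 2 * n)); split; first exact: sum_nbrs_excess.
have linkK x : npairs (link F x) (transpositions n) (transpositions n) <= K.
  rewrite leqNgt; apply/negP => ltK.
  have k0 : 0 < k by lia.
  have [v [c [u [cc uc sc _ _]]]] :=
    even_cycle_with_pendant (@link_sym n F x) (@link_irr n F x) k0 ltT ltK.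
  by move/negP: noC; apply; apply: (has_cycle_of_link cc uc sc); lia.
have := sum_sqr_ge [set: 'S_n] (fun y => #|nbrs F y| - 2 * n).
rewrite !sum_in_setT => le_sq; apply: leq_trans le_sq _.
rewrite cardsT card_Sn [n`! ^ 2]expnS expn1 -mulnA leq_mul2l; apply/orP; right.
apply: (@leq_trans (\sum_x npairs (link F x) (transpositions n) (transpositions n))).
  by rewrite sum_link_pairs; apply: leq_sum => y _; apply/link_pairs_ge/nbrsS.
apply: leq_trans (leq_sum _ (fun x _ => linkK x)) _.
by rewrite sum_nat_const card_Sn.
Qed.

Lemma link3_count_bound n (F : {set {set 'S_n}}) (m t : nat) (x : 'S_n) :
  ~~ has_cycle (2 * (2 * m + 3)) F -> 2 <= m -> #|transpositions n| < t ^ m ->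
  link3_count F x ^ 2 <= #|transpositions n| ^ 5 * (1 + 8 * (m + 1) * (t + 5)).
Proof.
move=> noC m2 ltT; set A := transpositions n; set T := #|A|.
pose d a b := \sum_(c in A) link3 F x a b c.
have linkK c1 c2 : c1 != c2 -> npairs (common_link F x c1 c2) A A <= 8 * (m + 1) * (t + 5) * T.
  move=> c12; rewrite leqNgt; apply/negP => ltK.
  have m0 : 0 < m by lia.
  have [v [c [u [cc uc sc vu nu]]]] := even_cycle_with_pendant
    (@common_link_sym n F x c1 c2) (@common_link_irr n F x c1 c2) m0 ltT ltK.
  by move/negP: noC; apply; apply: (has_cycle_of_common_link c12 cc uc sc _ vu nu); lia.
have d2 : \sum_(a in A) \sum_(b in A) d a b ^ 2 <= T ^ 3 * (1 + 8 * (m + 1) * (t + 5)).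
  (* The square of a codegree counts pairs [c1], [c2] of apexes over the same [a], [b]. *)
  have -> : \sum_(a in A) \sum_(b in A) d a b ^ 2 =
      \sum_(c1 in A) \sum_(c2 in A) npairs (common_link F x c1 c2) A A.
    transitivity (\sum_(a in A) \sum_(c1 in A) \sum_(c2 in A) \sum_(b in A)
        common_link F x c1 c2 a b).
      apply: eq_bigr => a _.
      transitivity (\sum_(b in A) \sum_(c1 in A) \sum_(c2 in A) common_link F x c1 c2 a b).
        apply: eq_bigr => b _; rewrite expnS expn1 /d big_distrl /=.
        apply: eq_bigr => c1 _; rewrite big_distrr /=.
        by apply: eq_bigr => c2 _; rewrite mulnb.
      rewrite exchange_big /=; apply: eq_bigr => c1 _; exact: exchange_big.
    rewrite exchange_big /=; apply: eq_bigr => c1 _; exact: exchange_big.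
  (* The diagonal [c1 = c2] admits only the trivial bound; it is the source of the summand 1. *)
  apply: (@leq_trans (\sum_(c1 in A) \sum_(c2 in A)
      ((c1 == c2) * T ^ 2 + 8 * (m + 1) * (t + 5) * T))).
    apply: leq_sum => c1 _; apply: leq_sum => c2 _.
    have [_|c12] := eqVneq c1 c2; last by rewrite add0n linkK.
    rewrite mul1n; apply: leq_trans (leq_addr _ _).
    rewrite /npairs expnS expn1 -sum_nat_const; apply: leq_sum => a _.
    rewrite /T -sum1_card; apply: leq_sum => b _; exact: leq_b1.
  rewrite (eq_bigr (fun=> T ^ 2 + T * (8 * (m + 1) * (t + 5) * T))).
    by rewrite sum_nat_const -/T !expnS expn0; nia.
  move=> c1 c1A; rewrite big_split /= sum_nat_const; congr (_ + _).
  rewrite (bigD1 c1) //= eqxx mul1n big1 ?addn0 // => c2 /andP[_ /negPf].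
  by rewrite eq_sym => ->.
apply: (@leq_trans (T * (T * \sum_(a in A) \sum_(b in A) d a b ^ 2))); last first.
  by rewrite mulnA mulnn (expnD T 2 3) -mulnA leq_mul2l d2 orbT.
apply: leq_trans (sum_sqr_ge A _) _; rewrite leq_mul2l; apply/orP; right.
rewrite big_distrr /=; apply: leq_sum => a _; exact: sum_sqr_ge.
Qed.

(** The cubes of the excesses over [4 * n] are bounded by the triple counts, whose squares are
    bounded by [Q]; hence the sixth power. *)
Lemma odd_cycle_free_bound n (F : {set {set 'S_n}}) (m t : nat) :
  is_subgraph F -> ~~ has_cycle (2 * (2 * m + 3)) F -> 2 <= m ->
  #|transpositions n| < t ^ m ->
  exists g, 2 * #|F| <= g + 4 * n * n`! /\
    g ^ 6 <= n`! ^ 6 * (#|transpositions n| ^ 5 * (1 + 8 * (m + 1) * (t + 5))).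
Proof.
move=> subF noC m2 ltT; set Q := #|_| ^ 5 * _.
exists (\sum_y (#|nbrs F y| - 4 * n)); split; first exact: sum_nbrs_excess.
have := sum_cube_ge [set: 'S_n] (fun y => #|nbrs F y| - 4 * n).
have := sum_sqr_ge [set: 'S_n] (link3_count F).
rewrite !sum_in_setT cardsT card_Sn => sq cube.
have sqQ : (\sum_x link3_count F x) ^ 2 <= n`! ^ 2 * Q.
  apply: leq_trans sq _; rewrite expnS expn1 -mulnA leq_mul2l; apply/orP; right.
  rewrite -(card_Sn n) -sum_nat_const; apply: leq_sum => x _.
  exact: link3_count_bound.
have cubeL : (\sum_y (#|nbrs F y| - 4 * n)) ^ 3 <= n`! ^ 2 * \sum_x link3_count F x.
  apply: leq_trans cube _; rewrite leq_mul2l; apply/orP; right.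
  by rewrite sum_link3_count; apply: leq_sum => y _; apply/link_triples_ge/nbrsS.
rewrite (expnM _ 3 2); apply: (@leq_trans ((n`! ^ 2 * \sum_x link3_count F x) ^ 2)).
  by rewrite leq_exp2r.
by rewrite expnMn -expnM (expnD _ 4 2) -mulnA leq_mul2l sqQ orbT.
Qed.

(** * Hexagons *)

(** Adjacent vertices have no common neighbour, so their degrees add up to at most [#|W|]. Sum this
    over all edges and apply Cauchy-Schwarz to the degrees. *)
Lemma mantel (V : finType) (e : rel V) (W : {set V}) :
  symmetric e -> (forall a b c, e a b -> e b c -> e a c -> False) ->
  2 * npairs e W W <= #|W| ^ 2.
Proof.
move=> esym tri; set E := npairs e W W; pose d := degree_in e W.
have Ed : E = \sum_(u in W) d u by [].
have dd u v : u \in W -> v \in W -> e u v * (d u + d v) <= e u v * #|W|.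
  move=> uW vW; case uv : (e u v) => //; rewrite !mul1n /d /degree_in -big_split /=.
  rewrite -sum1_card; apply: leq_sum => w _.
  have := tri u v w uv; case: (e u w); case: (e v w) => // /(_ isT isT).
  by case.
have sum_d : 2 * \sum_(u in W) d u ^ 2 <= #|W| * E.
  apply: (@leq_trans (\sum_(u in W) \sum_(v in W) e u v * (d u + d v))).
    rewrite eq_leq // mul2n -addnn.
    have E1 : \sum_(u in W) d u ^ 2 = \sum_(u in W) \sum_(v in W) e u v * d u.
      by apply: eq_bigr => u _; rewrite expnS expn1 {1}/d /degree_in big_distrl.
    have E2 : \sum_(u in W) d u ^ 2 = \sum_(u in W) \sum_(v in W) e u v * d v.
      rewrite E1 exchange_big; apply: eq_bigr => u _; apply: eq_bigr => v _.
      by rewrite esym.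
    rewrite {1}E1 E2 -big_split /=; apply: eq_bigr => u _; rewrite -big_split /=.
    by apply: eq_bigr => v _; rewrite mulnDr.
  rewrite mulnC /E /npairs big_distrl /=; apply: leq_sum => u uW.
  by rewrite big_distrl /=; apply: leq_sum => v vW; apply: dd.
have := sum_sqr_ge W d; rewrite -Ed => sq.
have [->|E0] := posnP E; first by rewrite muln0.
rewrite -(leq_pmul2r E0) -mulnA mulnn.
apply: leq_trans (leq_mul (leqnn 2) sq) _; rewrite mulnCA expnS expn1 -mulnA leq_mul2l.
by rewrite sum_d orbT.
Qed.

Lemma npairsC (V : finType) (e : rel V) (A B : {set V}) :
  symmetric e -> npairs e A B = npairs e B A.
Proof.
move=> esym; rewrite /npairs exchange_big; apply: eq_bigr => u _.
by apply: eq_bigr => v _; rewrite esym.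
Qed.

(** Each direction has at most one link neighbour in [D], so at most [2 * #|A|] ordered pairs meet
    [D]; Mantel's theorem bounds those outside [D]. *)
Lemma link_pairs_C6_free n (F : {set {set 'S_n}}) (x : 'S_n) :
  ~~ has_cycle 6 F ->
  2 * npairs (link F x) (transpositions n) (transpositions n) <=
    4 * #|transpositions n| + (#|transpositions n| - #|nbrs F x|) ^ 2.
Proof.
move=> noC; set A := transpositions n; set D := nbrs F x.
have DA : D \subset A := nbrsS F x.
have pD : npairs (link F x) A D <= #|A|.
  rewrite /npairs -sum1_card; apply: leq_sum => a _.
  rewrite -big_mkcondr /= sum1dep_card leqNgt; apply/negP => /card_gt1P.
  case=> b [c [+ + bc]]; rewrite !inE => /andP[/andP[_ xb] ab] /andP[/andP[_ xc] ac].
  by move/negP: noC; apply; apply: (has_cycle6_of_two_neighbours bc ab ac).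
have pW : 2 * npairs (link F x) (A :\: D) (A :\: D) <= (#|A| - #|D|) ^ 2.
  have <- : #|A :\: D| = #|A| - #|D| by rewrite cardsD (setIidPr DA).
  apply: mantel; first exact: link_sym.
  move=> a b c ab bc ac; move/negP: noC; apply.
  apply: (@has_cycle_of_link n F x [:: a; b; c] 3) => //.
    by rewrite /= ab bc link_sym ac.
  rewrite /= !inE negb_or andbT; apply/andP; split.
    by apply/andP; split; apply/eqP => E; [move: ab|move: ac]; rewrite E link_irr.
  by apply/eqP => E; move: bc; rewrite E link_irr.
have split2 : npairs (link F x) A A = npairs (link F x) A D +
    (npairs (link F x) D (A :\: D) + npairs (link F x) (A :\: D) (A :\: D)).
  have splr (B : {set 'S_n}) : npairs (link F x) B A =
      npairs (link F x) B D + npairs (link F x) B (A :\: D).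
    rewrite /npairs -big_split; apply: eq_bigr => u _.
    by rewrite (big_setID D) /= (setIidPr DA).
  rewrite splr; congr (_ + _).
  by rewrite [LHS](big_setID D) /= (setIidPr DA).
have le3 : npairs (link F x) D (A :\: D) <= npairs (link F x) A D.
  rewrite (npairsC A D (@link_sym n F x)) /npairs; apply: leq_sum => u _.
  by rewrite [X in _ <= X](big_setID D) leq_addl.
lia.
Qed.

(** With T transpositions and p the density 2 [#|F|] / (T n!), this says p^2 + 2 p <= 1 + (4 + 4 n)
    / T. *)
Lemma C6_free_bound n (F : {set {set 'S_n}}) :
  is_subgraph F -> ~~ has_cycle 6 F ->
  (2 * #|F|) ^ 2 + 2 * (#|transpositions n| * n`!) * (2 * #|F|) <=
    n`! ^ 2 * (#|transpositions n| * (4 + #|transpositions n| + 4 * n)).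
Proof.
move=> subF noC; set T := #|transpositions n|; rewrite -(sum_card_nbrs subF).
have := sum_sqr_ge [set: 'S_n] (fun y => #|nbrs F y|).
rewrite !sum_in_setT cardsT card_Sn => sq.
have dT y : #|nbrs F y| <= T by apply/subset_leq_card/nbrsS.
have pairs_ge y : #|nbrs F y| ^ 2 <=
    \sum_(u in nbrs F y) \sum_(v in nbrs F y) dj u v + 2 * n * #|nbrs F y|.
  have le1 : #|nbrs F y| * (#|nbrs F y| - 2 * n) <=
      \sum_(u in nbrs F y) \sum_(v in nbrs F y) dj u v.
    rewrite -sum_nat_const; apply: leq_sum => u /(subsetP (nbrsS F y)).
    exact: sum_dj_ge (nbrsS F y).
  apply: leq_trans (leq_add le1 (leqnn _)); rewrite expnS expn1; nia.
have key : \sum_y (#|nbrs F y| ^ 2 + 2 * T * #|nbrs F y|) <=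
    n`! * (T * (4 + T + 4 * n)).
  have le2 : \sum_y 2 * #|nbrs F y| ^ 2 <=
      \sum_y (4 * T + (T - #|nbrs F y|) ^ 2 + 4 * n * #|nbrs F y|).
    apply: (@leq_trans (\sum_y (2 * (\sum_(u in nbrs F y) \sum_(v in nbrs F y) dj u v)
        + 4 * n * #|nbrs F y|))).
      by apply: leq_sum => y _; have := pairs_ge y; lia.
    rewrite big_split [X in _ <= X]big_split /= leq_add2r.
    apply: (@leq_trans (2 * \sum_x
        npairs (link F x) (transpositions n) (transpositions n))).
      by rewrite sum_link_pairs big_distrr.
    by rewrite big_distrr; apply: leq_sum => x _; apply: link_pairs_C6_free.
  have := leq_add le2 (leqnn (\sum_y (2 * T * #|nbrs F y|))).
  rewrite -!big_split /= => le3.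
  rewrite -(leq_add2l (\sum_y #|nbrs F y| ^ 2)) -big_split /=.
  rewrite -(card_Sn n) -sum_nat_const -big_split /=.
  apply: leq_trans (leq_trans le3 _).
    by apply: leq_sum => y _; lia.
  (* [z] stands for the truncated difference [U - d]. *)
  have arith U d z : z + d = U ->
      4 * U + z ^ 2 + 4 * n * d + 2 * U * d <= d ^ 2 + U * (4 + U + 4 * n).
    by clear; move=> <-; rewrite !expnS !expn0 !muln1; nia.
  by apply: leq_sum => y _; apply: arith; apply: subnK.
apply: (@leq_trans (n`! * \sum_y (#|nbrs F y| ^ 2 + 2 * T * #|nbrs F y|))).
  rewrite big_split /= -big_distrr /=.
  have := sq; set S1 := \sum_y #|_|; set S2 := \sum_y _ ^ 2 => sq'.
  by rewrite mulnDr; apply: leq_add => //; rewrite eq_leq //; lia.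
by rewrite [n`! ^ 2]expnS expn1 -mulnA leq_mul2l key orbT.
Qed.

(** * Four-cycles *)

(** For a transposition [t], an absent edge in direction [t] is counted at both its ends. *)
Definition missing (n : nat) (F : {set {set 'S_n}}) (t : 'S_n) : nat :=
  \sum_x (t \notin nbrs F x).

Lemma sum_missing n (F : {set {set 'S_n}}) : is_subgraph F ->
  \sum_(t in transpositions n) missing F t + 2 * #|F| = 2 * eCT n.
Proof.
move=> subF; rewrite -(sum_card_nbrs subF) eCT_double exchange_big /= -big_split /=.
rewrite -(card_Sn n) -sum_nat_const; apply: eq_bigr => x _.
rewrite -[#|nbrs F x|]sum1_card (sum_subset _ (nbrsS F x)) -big_split /= -sum1_card.
by apply: eq_bigr => t _; case: (_ \in _).
Qed.

(** From every [x] the directions [a], [b], [a], [c] lead around a 4-cycle, as [c] equals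
    [a * b * a]; one of its edges is missing. Translating [x] lets each edge be counted from the
    start of the cycle. *)
Lemma missing_triangle n (F : {set {set 'S_n}}) (i j k : 'I_n) :
  ~~ has_cycle 4 F -> i != j -> i != k -> j != k ->
  n`! <= 2 * missing F (tperm i j) + missing F (tperm j k) + missing F (tperm i k).
Proof.
move=> noC ij ik jk; set a := tperm i j; set b := tperm j k; set c := tperm i k.
have aT : a \in transpositions n by apply/transpositionP; exists i, j.
have bT : b \in transpositions n by apply/transpositionP; exists j, k.
have cT : c \in transpositions n by apply/transpositionP; exists i, k.
have abaE : (a * b * a = c)%g.
  rewrite -{1}(transpositionV aT) -mulgA -conjgE /a /b tpermJ tpermR tpermD //.
have ab : (a * b != b * a)%g.
  apply/eqP => comm; move: abaE; rewrite comm -mulgA (transpositionK aT) mulg1.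
  move/(congr1 (fun s : 'S_n => s k)); rewrite /b /c !tpermR => /eqP.
  by rewrite eq_sym (negPf ij).
have shift (s t : 'S_n) : missing F t = \sum_x (t \notin nbrs F (s * x)%g).
  by rewrite /missing (reindex_inj (mulgI s)).
rewrite mul2n -addnn {2}(shift (b * a)%g a) (shift a b) (shift (a * b * a)%g c).
rewrite /missing -!big_split /= -(card_Sn n) -sum1_card.
rewrite (eq_bigl predT) => [|x]; last by [].
apply: leq_sum => x _; rewrite !in_nbrs // !mulgA.
have -> : (c * a * b * a * x = x)%g.
  by rewrite -abaE -!mulgA !(mulgA a a) transpositionK // mul1g (mulgA b b)
    transpositionK // mul1g mulgA transpositionK // mul1g.
have := @has_cycle4_of_overlap n F x a b aT bT ab.
case: (adj F x _) => //; case: (adj F (a * x)%g _); rewrite ?addn1 ?addnS //.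
case: (adj F (b * a * x)%g _); rewrite ?addn1 ?addnS //.
case: (adj F (a * b * a * x)%g _); rewrite ?addn1 ?addnS //.
by move=> /(_ isT isT isT isT) C4; rewrite C4 in noC.
Qed.

(** Sum [missing_triangle] over ordered triples of distinct points. By symmetry all terms contribute
    alike, so on average a direction is missing at a quarter of the vertices or more. *)
Lemma C4_free_bound n (F : {set {set 'S_n}}) :
  3 <= n -> is_subgraph F -> ~~ has_cycle 4 F -> 4 * #|F| <= 3 * eCT n.
Proof.
move=> n3 subF noC.
pose d (i j k : 'I_n) := [&& i != j, i != k & j != k].
pose m (i j : 'I_n) := missing F (tperm i j).
have dsum i j : \sum_k d i j k = (i != j) * (n - 2).
  case: (boolP (i == j)) => [ij|ij] /=.
    by rewrite big1 // => k _; rewrite /d ij.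
  rewrite mul1n -big_mkcond /= sum1dep_card.
  rewrite (eq_card (B := ~: [set i; j])) => [|k].
    by rewrite cardsCs setCK cards2 ij card_ord.
  by rewrite !inE negb_or /d ij ![k == _]eq_sym.
have S1 : \sum_i \sum_j \sum_k d i j k * m i j =
    (n - 2) * (2 * \sum_(t in transpositions n) missing F t).
  rewrite -sum_transpositions big_distrr; apply: eq_bigr => i _ /=.
  rewrite big_distrr [RHS]big_mkcond /=; apply: eq_bigr => j _.
  rewrite -big_distrl /= dsum [j == i]eq_sym; case: (i != j) => //=.
  by rewrite mul1n.
have S2 : \sum_i \sum_j \sum_k d i j k * m i k = \sum_i \sum_j \sum_k d i j k * m i j.
  apply: eq_bigr => i _; rewrite exchange_big; apply: eq_bigr => j _.
  by apply: eq_bigr => k _; rewrite /d [k == j]eq_sym andbCA.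
have S3 : \sum_i \sum_j \sum_k d i j k * m j k = \sum_i \sum_j \sum_k d i j k * m i j.
  rewrite exchange_big -S2; apply: eq_bigr => i _; apply: eq_bigr => j _.
  by apply: eq_bigr => k _; rewrite /d [j == i]eq_sym; congr (_ && _ * _); rewrite andbC.
have S0 : \sum_i \sum_j \sum_k d i j k * n`! =
    (n - 2) * (2 * #|transpositions n|) * n`!.
  rewrite -sum1_card -sum_transpositions big_distrr big_distrl.
  apply: eq_bigr => i _ /=.
  rewrite big_distrr [in RHS]big_mkcond big_distrl /=; apply: eq_bigr => j _.
  rewrite -big_distrl /= dsum [j == i]eq_sym; case: (i != j) => //=.
  by rewrite mul1n muln1.
have le : \sum_i \sum_j \sum_k d i j k * n`! <=
    4 * \sum_i \sum_j \sum_k d i j k * m i j.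
  have -> : 4 * \sum_i \sum_j \sum_k d i j k * m i j =
      \sum_i \sum_j \sum_k d i j k * (2 * m i j + m j k + m i k).
    transitivity (\sum_i \sum_j \sum_k (d i j k * m i j + d i j k * m i j
        + d i j k * m j k + d i j k * m i k)).
      have add3 (f g : 'I_n -> 'I_n -> 'I_n -> nat) :
          \sum_i \sum_j \sum_k (f i j k + g i j k) =
          \sum_i \sum_j \sum_k f i j k + \sum_i \sum_j \sum_k g i j k.
        rewrite -big_split; apply: eq_bigr => i _; rewrite -big_split.
        by apply: eq_bigr => j _; rewrite -big_split.
      rewrite !add3 S2 S3; set Z := \sum_i _; clearbody Z; clear; lia.
    apply: eq_bigr => i _; apply: eq_bigr => j _; apply: eq_bigr => k _.
    by rewrite mul2n -addnn !mulnDr.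
  apply: leq_sum => i _; apply: leq_sum => j _; apply: leq_sum => k _.
  case: (boolP (d i j k)) => //= /and3P[ij ik jk]; rewrite !mul1n.
  exact: missing_triangle.
have := sum_missing subF; have := eCT_double n; move: le; rewrite S0 S1.
set X := \sum_(t in _) _; set T := #|transpositions n|; set f := n`! => le e1 e2.
have {le} : T * f <= 4 * X.
  have n2 : 0 < n - 2 by lia.
  by rewrite -(leq_pmul2l n2); clearbody X T f; clear -le; lia.
lia.
Qed.

(** * Asymptotics *)

Local Open Scope R_scope.

Lemma INR_leq m n : (m <= n)%N -> INR m <= INR n.
Proof. by move=> /leP; apply: le_INR. Qed.

Lemma INR_addn m n : INR (m + n)%N = INR m + INR n.
Proof. exact: plus_INR. Qed.

Lemma INR_muln m n : INR (m * n)%N = INR m * INR n.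
Proof. exact: mult_INR. Qed.

Lemma INR_expn m n : INR (m ^ n)%N = INR m ^ n.
Proof. by elim: n => //= n IH; rewrite expnS INR_muln IH. Qed.

Definition INRE := (INR_addn, INR_muln, INR_expn).

Lemma pow_le_inv (k : nat) (x y : R) : (0 < k)%N -> 0 <= y -> x ^ k <= y ^ k -> x <= y.
Proof.
move=> k0 y0 le_xy; apply: Rnot_lt_le => lt_yx; apply: (Rlt_not_le _ _ _ le_xy).
case: k k0 {le_xy} => // k _; elim: k => [|k IH]; first by rewrite /=; lra.
rewrite -[x ^ _]/(x * x ^ k.+1) -[y ^ _]/(y * y ^ k.+1).
have : 0 <= y ^ k.+1 by exact: pow_le.
nra.
Qed.

Lemma exCT_le n m (B : R) : 0 <= B ->
  (forall F : {set {set 'S_n}}, is_subgraph F -> ~~ has_cycle m F -> INR #|F| <= B) ->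
  INR (exCT n m) <= B.
Proof.
move=> B0 bF; rewrite /exCT; apply: (big_ind (fun x : nat => INR x <= B)) => //.
  by move=> x y; rewrite /maxn; case: ifP.
by move=> F /andP[]; apply: bF.
Qed.

Lemma eCT_INR n : 2 * INR (eCT n) = INR n`! * INR #|transpositions n|.
Proof. by have /(congr1 INR) := eCT_double n; rewrite !INRE. Qed.

Lemma transpositions_INR n : (3 <= n)%N ->
  2 * INR #|transpositions n| = INR n * (INR n - 1).
Proof.
case: n => // n n3; have /(congr1 INR) := card_transpositions n.+1.
rewrite !INRE -pred_Sn (S_INR n) [INR 2]/= => ->; lra.
Qed.

Lemma INR_ge3 n : (3 <= n)%N -> 3 <= INR n.
Proof. by move/INR_leq => /=; lra. Qed.

Lemma fact_INR_gt0 n : 0 < INR n`!.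
Proof. by apply: lt_0_INR; apply/ltP; apply: fact_gt0. Qed.

(** The factor 3 comes from n^2 <= 3 T for the number T of transpositions, with equality at
    [n = 3]. *)
Lemma rescale_bound n (f : nat) (c E : R) : (3 <= n)%N -> 0 <= c ->
  2 * INR f <= INR n`! * (c * Rpower (INR n) (E + 2)) ->
  INR f <= 3 * c * Rpower (INR n) E * INR (eCT n).
Proof.
move=> n3 c0; have N3 := INR_ge3 n3; have M0 := fact_INR_gt0 n.
have := eCT_INR n; have := transpositions_INR n3.
set T := INR #|_|; set N := INR n in N3 *; set M := INR n`! in M0 * => TE eE.
have -> : Rpower N (E + 2) = Rpower N E * N ^ 2.
  by rewrite Rpower_plus -(Rpower_pow 2) //; lra.
have P0 : 0 < Rpower N E by exact: exp_pos.
set P := Rpower N E in P0 * => le_f.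
have TN : N ^ 2 <= 3 * T by nra.
have : M * (c * (P * N ^ 2)) <= M * (c * (P * (3 * T))).
  apply: Rmult_le_compat_l; first lra.
  apply: Rmult_le_compat_l => //; apply: Rmult_le_compat_l; lra.
have -> : M * (c * (P * (3 * T))) = 3 * c * P * (M * T) by ring.
rewrite -eE; lra.
Qed.

Lemma integer_root_exists (k T : nat) : (0 < k)%N ->
  exists t : nat, (T < t ^ k)%N /\ (t.-1 ^ k <= T)%N.
Proof.
move=> k0; have ex : exists t : nat, (T < t ^ k)%N.
  exists T.+1; elim: k k0 => // -[|k] IH _; first by rewrite expn1.
  by rewrite expnS; apply: leq_trans (IH isT) _; apply: leq_pmull.
exists (ex_minn ex); case: ex_minnP => -[|t] Tt min; split=> //.
  by move: Tt; rewrite exp0n.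
rewrite leqNgt; apply/negP => /min; by rewrite ltnn.
Qed.

(** The least admissible [t] satisfies [t.-1 <= P] for P = n^(2/k), and [P + 6 <= 7 * P] since
    [P >= 1]. *)
Lemma integer_root_bound n k : (3 <= n)%N -> (0 < k)%N ->
  exists t : nat, (#|transpositions n| < t ^ k)%N /\
    INR t + 5 <= 7 * Rpower (INR n) (2 / INR k).
Proof.
move=> n3 k0; have N3 := INR_ge3 n3; have TE := transpositions_INR n3.
have [t [Tt tT]] := integer_root_exists #|transpositions n| k0.
exists t; split=> //; set P := Rpower _ _.
have kR : 0 < INR k by apply: lt_0_INR; apply/ltP.
have P1 : 1 <= P.
  rewrite -(Rpower_O (INR n)); last lra.
  by apply: Rle_Rpower; [lra | apply: Rlt_le; apply: Rdiv_lt_0_compat; lra].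
have : INR t.-1 <= P.
  apply: (@pow_le_inv k) => //; first lra.
  have -> : P ^ k = INR n ^ 2.
    rewrite -(Rpower_pow k); last exact: exp_pos.
    rewrite /P Rpower_mult -(Rpower_pow 2); last lra.
    congr Rpower; rewrite /=; field; lra.
  apply: (Rle_trans _ (INR #|transpositions n|)).
    by rewrite -INR_expn; apply: INR_leq.
  rewrite -Rsqr_pow2 /Rsqr; nra.
case: t {Tt tT} => [|t]; first by rewrite /=; lra.
rewrite -pred_Sn (S_INR t); lra.
Qed.

Lemma Rpower_INR_le n a b : (3 <= n)%N -> a <= b ->
  Rpower (INR n) a <= Rpower (INR n) b.
Proof. by move=> /INR_ge3 N3 ab; apply: Rle_Rpower; lra. Qed.

Lemma INR_le_Rpower n a : (3 <= n)%N -> 1 <= a -> INR n <= Rpower (INR n) a.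
Proof.
move=> n3 a1; have N3 := INR_ge3 n3.
rewrite -{1}(Rpower_1 (INR n)); [exact: Rpower_INR_le | lra].
Qed.

Lemma even_cycle_real_bound (k : nat) : (2 <= k)%N ->
  exists C : R, 0 < C /\ forall n : nat, (3 <= n)%N ->
    INR (exCT n (2 * (2 * k))) <= C * Rpower (INR n) (-1 + 1 / INR k) * INR (eCT n).
Proof.
move=> k2; have kR : 2 <= INR k by have := INR_leq k2; rewrite /=; lra.
(* 56 is 8 times the 7 of [integer_root_bound], the summand 2 pays for the loss [2 * n] in the
   degrees, and 3 comes from [rescale_bound]. *)
pose c := 56 * (INR k + 1); exists (3 * (c + 2)); split; first by rewrite /c; lra.
move=> n n3; have N3 := INR_ge3 n3; have M0 := fact_INR_gt0 n.
have TE := transpositions_INR n3.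
set E := -1 + 1 / INR k; have P0 : 0 < Rpower (INR n) E by exact: exp_pos.
apply: exCT_le => [|F subF noC].
  apply: Rmult_le_pos; last exact: pos_INR.
  by apply: Rmult_le_pos; rewrite /c; lra.
apply: rescale_bound => //; first by rewrite /c; lra.
have [|t [Tt t_le]] := @integer_root_bound n k n3; first by lia.
have [g [Fg g_le]] := even_cycle_free_bound subF noC k2 Tt.
have kV : 0 < 1 / INR k by apply: Rdiv_lt_0_compat; lra.
have NY : INR n <= Rpower (INR n) (E + 2) by apply: INR_le_Rpower => //; rewrite /E; lra.
have Y2 : Rpower (INR n) (E + 2) ^ 2 = INR n ^ 2 * Rpower (INR n) (2 / INR k).
  rewrite -(Rpower_pow 2); last exact: exp_pos.
  rewrite Rpower_mult -(Rpower_pow 2 (INR n)) -?Rpower_plus; last lra.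
  congr Rpower; rewrite /E /=; field; lra.
have {}g_le : INR g ^ 2 <= (INR n`! * (c * Rpower (INR n) (E + 2))) ^ 2.
  have := INR_leq g_le; rewrite !INRE => {}g_le; apply: Rle_trans g_le _.
  rewrite !Rpow_mult_distr; apply: Rmult_le_compat_l; first by apply: pow_le; lra.
  rewrite Y2; set P := Rpower _ (2 / _) in t_le *.
  have T2 : INR #|transpositions n| <= INR n ^ 2 by rewrite -Rsqr_pow2 /Rsqr; nra.
  have T0 := pos_INR #|transpositions n|; have t0 := pos_INR t.
  have -> : INR 8 = 8 by rewrite /=; lra.
  have -> : INR 5 = 5 by rewrite /=; lra.
  have -> : INR 1 = 1 by [].
  apply: (Rle_trans _ (8 * (INR k + 1) * (7 * P) * INR n ^ 2)).
    by apply: Rmult_le_compat => //; nra.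
  rewrite (_ : 8 * _ * _ * _ = c * (INR n ^ 2 * P)); last by rewrite /c; ring.
  have : 0 <= INR n ^ 2 * P by rewrite /=; nra.
  rewrite /c; nra.
have {}g_le : INR g <= INR n`! * (c * Rpower (INR n) (E + 2)).
  apply: (@pow_le_inv 2) => //; apply: Rmult_le_pos; first lra.
  by rewrite /c; nra.
have := INR_leq Fg; rewrite !INRE (_ : INR 2 = 2) //= => {}Fg.
by apply: Rle_trans Fg _; nra.
Qed.

(** The method gives the exponent -1/3 + 1/(3m); any larger [E] is allowed, with the same constant,
    to fit both exponents of the theorem. *)
Lemma odd_cycle_real_bound (m : nat) : (2 <= m)%N ->
  exists C : R, 0 < C /\ forall (n : nat) (E : R), (3 <= n)%N ->
    5 / 3 + 1 / (3 * INR m) <= E + 2 ->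
    INR (exCT n (2 * (2 * m + 3))) <= C * Rpower (INR n) E * INR (eCT n).
Proof.
move=> m2; have mR : 2 <= INR m by have := INR_leq m2; rewrite /=; lra.
(* 57 covers [1 + 8 * 7 * (m + 1)] up to the factor [m + 1], and 4 the degree loss [4 * n]. *)
pose c := 57 * (INR m + 1); exists (3 * (c + 4)); split; first by rewrite /c; lra.
move=> n E n3 leE; have N3 := INR_ge3 n3; have M0 := fact_INR_gt0 n.
have TE := transpositions_INR n3; have P0 : 0 < Rpower (INR n) E by exact: exp_pos.
apply: exCT_le => [|F subF noC].
  apply: Rmult_le_pos; last exact: pos_INR.
  by apply: Rmult_le_pos; rewrite /c; lra.
apply: rescale_bound => //; first by rewrite /c; lra.
have [|t [Tt t_le]] := @integer_root_bound n m n3; first by lia.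
have [g [Fg g_le]] := odd_cycle_free_bound subF noC m2 Tt.
have mV : 0 < 1 / (3 * INR m) by apply: Rdiv_lt_0_compat; lra.
set e0 := 5 / 3 + _ in leE; set Y := Rpower (INR n) e0.
have YE : Y <= Rpower (INR n) (E + 2) by exact: Rpower_INR_le.
have NY : INR n <= Y by apply: INR_le_Rpower => //; rewrite /e0; lra.
have Y6 : Y ^ 6 = INR n ^ 10 * Rpower (INR n) (2 / INR m).
  rewrite -(Rpower_pow 6); last exact: exp_pos.
  rewrite Rpower_mult -(Rpower_pow 10 (INR n)) -?Rpower_plus; last lra.
  congr Rpower; rewrite /e0 /=; field; lra.
have {}g_le : INR g ^ 6 <= (INR n`! * (c * Y)) ^ 6.
  have := INR_leq g_le; rewrite !INRE => {}g_le; apply: Rle_trans g_le _.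
  rewrite Rpow_mult_distr (Rpow_mult_distr c); apply: Rmult_le_compat_l; first by apply: pow_le; lra.
  rewrite Y6; set P := Rpower _ (2 / _) in t_le *.
  have T2 : INR #|transpositions n| <= INR n ^ 2 by rewrite -Rsqr_pow2 /Rsqr; nra.
  have T0 := pos_INR #|transpositions n|; have t0 := pos_INR t.
  have T5 : INR #|transpositions n| ^ 5 <= INR n ^ 10.
    by rewrite (pow_mult _ 2 5); apply: pow_incr.
  have -> : INR 8 = 8 by rewrite /=; lra.
  have -> : INR 5 = 5 by rewrite /=; lra.
  have -> : INR 1 = 1 by [].
  have c1 : c <= c ^ 6.
    rewrite -{1}(pow_1 c); apply: Rle_pow; [rewrite /c; lra | by apply/leP].
  rewrite (_ : c ^ 6 * (INR n ^ 10 * P) = INR n ^ 10 * (c ^ 6 * P)); last by ring.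
  apply: Rmult_le_compat => //; first exact: pow_le.
    by nra.
  apply: (Rle_trans _ (c * P)); last by apply: Rmult_le_compat_r => //; lra.
  rewrite /c; nra.
have {}g_le : INR g <= INR n`! * (c * Y).
  apply: (@pow_le_inv 6) => //; apply: Rmult_le_pos; first lra.
  by rewrite /c; nra.
have := INR_leq Fg; rewrite !INRE (_ : INR 2 = 2) // (_ : INR 4 = 4); last by rewrite /=; lra.
move=> {}Fg; apply: Rle_trans Fg _.
have MY : INR n`! * ((c + 4) * Y) <= INR n`! * ((c + 4) * Rpower (INR n) (E + 2)).
  apply: Rmult_le_compat_l; first lra.
  by apply: Rmult_le_compat_l => //; rewrite /c; lra.
apply: Rle_trans MY; nra.
Qed.

Lemma C6_real_bound n : (3 <= n)%N ->
  INR (exCT n 6) <= (sqrt 2 - 1 + 24 / INR n) * INR (eCT n).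
Proof.
move=> n3; have N3 := INR_ge3 n3; have M0 := fact_INR_gt0 n.
have TE := transpositions_INR n3; have eE := eCT_INR n.
have s2 : sqrt 2 * sqrt 2 = 2 by apply: sqrt_sqrt; lra.
have s1 : 1 <= sqrt 2 by rewrite -{1}sqrt_1; apply: sqrt_le_1; lra.
have d0 : 0 < 24 / INR n by apply: Rdiv_lt_0_compat; lra.
have e0 := pos_INR (eCT n).
apply: exCT_le => [|F subF noC]; first by nra.
have := INR_leq (C6_free_bound subF noC); rewrite !INRE.
have -> : INR 2 = 2 by [].
have -> : INR 4 = 4 by rewrite /=; lra.
set S := 2 * INR #|F|; set T := INR #|transpositions n| in TE eE *.
set M := INR n`! in M0 eE *; set N := INR n in N3 TE d0 *; set d := 24 / N in d0 *.
have S0 : 0 <= S by rewrite /S; have := pos_INR #|F|; lra.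
have dN : d * N = 24 by rewrite /d; field; lra.
have T0 : 0 < T by nra.
pose D := T * M; have D0 : 0 < D by exact: Rmult_lt_0_compat.
(* The constant 24 makes [T * d] equal to [12 * (N - 1)], enough for the lower order terms. *)
have Td : 4 + 4 * N <= T * d.
  have -> : T * d = 12 * (N - 1).
    have -> : T = N * (N - 1) / 2 by lra.
    have -> : N * (N - 1) / 2 * d = (d * N) * (N - 1) / 2 by field.
    by rewrite dN; field.
  lra.
move=> key.
(* Completing the square: (p + 1)^2 <= 2 + d <= (sqrt 2 + d)^2 for p = S / D. *)
have key2 : (S + D) ^ 2 <= (D * (sqrt 2 + d)) ^ 2.
  have h1 : M ^ 2 * (T * (4 + T + 4 * N)) <= D ^ 2 + D ^ 2 * d.
    rewrite (_ : M ^ 2 * _ = D ^ 2 + M ^ 2 * T * (4 + 4 * N)); last by rewrite /D; ring.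
    rewrite (_ : D ^ 2 * d = M ^ 2 * T * (T * d)); last by rewrite /D; ring.
    apply: Rplus_le_compat_l; apply: Rmult_le_compat_l => //.
    by apply: Rmult_le_pos; [apply: pow_le|]; lra.
  have h2 : (D * (sqrt 2 + d)) ^ 2 = D ^ 2 * (2 + 2 * sqrt 2 * d + d ^ 2).
    transitivity (D ^ 2 * (sqrt 2 * sqrt 2 + 2 * sqrt 2 * d + d ^ 2)); first ring.
    by rewrite s2.
  have D2 : 0 <= D ^ 2 by apply: pow_le; lra.
  rewrite h2; apply: (Rle_trans _ (D ^ 2 * (2 + d))).
    rewrite (_ : (S + D) ^ 2 = S ^ 2 + 2 * (T * M) * S + D ^ 2); last by rewrite /D; ring.
    lra.
  apply: Rmult_le_compat_l => //; nra.
have : S + D <= D * (sqrt 2 + d).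
  by apply: (@pow_le_inv 2) => //; apply: Rmult_le_pos; lra.
have -> : INR (eCT n) = D / 2 by rewrite /D; lra.
rewrite (_ : INR #|F| = S / 2); last by rewrite /S; lra.
nra.
Qed.

Lemma Un_cv_div_INR (c : R) : 0 <= c -> Un_cv (fun n => c / INR n) 0.
Proof.
move=> c0 e e0; have [n0 n0P] := INR_unbounded (c / e).
exists n0 => n /le_INR n_ge.
have ce : 0 <= c / e by apply: Rle_mult_inv_pos; lra.
have N0 : 0 < INR n by lra.
rewrite /Rdist Rminus_0_r Rabs_pos_eq; last by apply: Rle_mult_inv_pos; lra.
apply: (Rmult_lt_reg_r (INR n)) => //.
rewrite (_ : c / INR n * INR n = c / e * e); last by field; lra.
by rewrite [e * _]Rmult_comm; apply: Rmult_lt_compat_r; lra.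
Qed.

Theorem theorem1p1 :
  (* (i) l >= 4 even *)
  (forall l : nat, (4 <= l)%N -> ~~ odd l ->
     exists C : R, (0 < C) /\
       forall n : nat, (3 <= n)%N ->
         (INR (exCT n (2 * l)%N) <=
            C * Rpower (INR n) (-1 + 2 / INR l) * INR (eCT n))) /\
  (* (ii) l >= 4 odd *)
  (forall l : nat, (4 <= l)%N -> odd l ->
     exists C : R, (0 < C) /\
       forall n : nat, (3 <= n)%N ->
         (l = 7%N ->
            (INR (exCT n (2 * l)%N) <=
               C * Rpower (INR n) (- (1 / INR l)) * INR (eCT n))) /\
         (l <> 7%N ->
            (INR (exCT n (2 * l)%N) <=
               C * Rpower (INR n) (- (1 / 8) + 1 / (4 * (INR l - 3)))
                 * INR (eCT n)))) /\
  (* (iii) l = 3 : ex(CT_n, C_6) <= (sqrt 2 - 1 + o(1)) e(CT_n) *)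
  (exists eps : nat -> R, Un_cv eps 0 /\
     forall n : nat, (3 <= n)%N ->
       (INR (exCT n 6) <= (sqrt 2 - 1 + eps n) * INR (eCT n))) /\
  (* (iv) l = 2 *)
  (forall n : nat, (3 <= n)%N ->
     (INR (exCT n 4) <= 3 / 4 * INR (eCT n))).
Proof.
split; [|split; [|split]].
- move=> l l4 lev; have lE : l = (2 * l./2)%N by rewrite mul2n even_halfK.
  have k2 : (2 <= l./2)%N by rewrite -(leq_pmul2l (isT : 0 < 2)%N) -lE.
  have kR : 2 <= INR l./2 by have := INR_leq k2; rewrite /=; lra.
  have [C [C0 bnd]] := even_cycle_real_bound k2; exists C; split=> // n n3.
  have -> : -1 + 2 / INR l = -1 + 1 / INR l./2.
    rewrite {1}lE INR_muln (_ : INR 2 = 2) //; field; lra.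
  by rewrite {1}lE; apply: bnd.
(* For [l = 5] the exponent is 0 and the trivial bound suffices; otherwise [l >= 7], so that
   [m >= 2]. *)
- move=> l l4 lodd; have [l5|l5] := eqVneq l 5%N.
    subst l; exists 1; split; first lra.
    move=> n n3; split=> // _.
    have -> : - (1 / 8) + 1 / (4 * (INR 5 - 3)) = 0.
      by rewrite (_ : INR 5 = 5); [field | rewrite /=; lra].
    rewrite Rpower_O ?Rmult_1_l; last by have := INR_ge3 n3; lra.
    by apply: exCT_le => [|F /subset_leq_card/INR_leq]; [exact: pos_INR|].
  pose m := (l - 3)./2; have lE : l = (2 * m + 3)%N.
    by rewrite /m mul2n even_halfK ?subnK // ?oddB ?lodd //; apply: ltnW.
  have m2 : (2 <= m)%N by clearbody m; lia.
  have mR : 2 <= INR m by have := INR_leq m2; rewrite /=; lra.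
  have lR : INR l = 2 * INR m + 3.
    by rewrite lE !INRE (_ : INR 3 = 3) //=; lra.
  have mV : 0 < 1 / INR m <= 1 / 2.
    split; first by apply: Rdiv_lt_0_compat; lra.
    by rewrite /Rdiv !Rmult_1_l; apply: Rinv_le_contravar; lra.
  have [C [C0 bnd]] := odd_cycle_real_bound m2; exists C; split=> // n n3.
  have e3 : 1 / (3 * INR m) = 1 / INR m / 3 by field; lra.
  (* For [l = 7] the method gives -1/6, below -1/7. In the other case the claimed exponent exceeds
     -1/3 + 1/(3m) by (5/24)(1 - 1/m). *)
  split=> [l7|_]; rewrite {1}lE; apply: bnd => //; rewrite e3 lR.
    have -> : INR m = 2 by rewrite l7 in lR; move: lR; rewrite /=; lra.
    lra.
  have -> : 1 / (4 * (2 * INR m + 3 - 3)) = 1 / INR m / 8 by field; lra.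
  lra.
- exists (fun n => 24 / INR n); split; first by apply: Un_cv_div_INR; lra.
  exact: C6_real_bound.
- move=> n n3; have e0 := pos_INR (eCT n).
  apply: exCT_le => [|F subF noC]; first lra.
  have := INR_leq (C4_free_bound n3 subF noC); rewrite !INRE.
  have -> : INR 4 = 4 by rewrite /=; lra.
  have -> : INR 3 = 3 by rewrite /=; lra.
  lra.
Qed.
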